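(* Adopt the setting and notation of the context (connected undirected graph $\mathcal G$ on $N$ nodes with Laplacian $\mathbf L$, private nodal data $\mathcal T^{(n)}$, parameters $\varpi\in[1/2,1)$, $\eta\in(0,2(1-\varpi))$, $\sigma>0$, $M\in\{1,2,\ldots\}$, $J_C\in\{1,\ldots,M\}$), with $\gamma:=1/\|\mathbf L\|_2=1/\lambda_1$. Then the following hold. (i) For every $\eta\in(0,2(1-\varpi))$, $0<\varrho(\eta)<1$. (ii) Let $\mathfrak Q[k]$ be the estimate formed by the distributed algorithm at the value-iteration index $k$, and let $(\mathfrak Q_m[k]=[Q_m^{(1)}[k],\ldots,Q_m^{(N)}[k]])_{m\in\mathbb N}$ be the sequence generated by recursion (Q). Then, for every node $n\in\{1,\ldots,N\}$, $$\bigl\|\,Q_m^{(n)}[k]-\mathbf T(\mathfrak Q[k])\,\mathbf 1_N\,\bigr\|=\mathcal O\bigl(m\,\varrho^m(\eta)\bigr),$$ where $\|\cdot\|$ is the Euclidean norm of $\mathbb R^D$. (iii) Let $(\mathfrak C_l=[\mathbf C_l^{(1)},\ldots,\mathbf C_l^{(N)}])_{l\in\mathbb N}$ be the sequence generated by recursion (C). Then, for every node $n\in\{1,\ldots,N\}$, $$\bigl\|\,\mathbf C_l^{(n)}-\boldsymbol\Phi_{\mathcal N}\boldsymbol\Phi_{\mathcal N}^{\top}\,\bigr\|_{\mathrm F}=\mathcal O\bigl(l\,\varrho^l(\eta)\bigr).$$ (iv) Suppose in addition that the centralized Bellman mapping $T_\odot$ is a contraction, i.e., there is $\beta_\odot\in(0,1)$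 with $\|T_\odot(Q_1)-T_\odot(Q_2)\|\le\beta_\odot\|Q_1-Q_2\|$ for all $Q_1,Q_2$ (so that $T_\odot$ has a unique fixed point $Q_\odot$), and that, for every node $n\in\{1,\ldots,N\}$, the sequence $(Q^{(n)}[k])_{k\in\mathbb N}$ produced by the distributed algorithm is bounded. Then there exists $C>0$ such that, for every node $n$, $$\limsup_{k\to\infty}\bigl\|\,Q^{(n)}[k]-Q_\odot\,\bigr\|\le C\,\frac{1}{1-\beta_\odot}\,M\,\varrho^M(\eta).$$
   Context: Notation: $\mathbb N=\{0,1,2,\ldots\}$; $\mathbf 1_N$ is the all-ones vector of $\mathbb R^N$; $\|\cdot\|_2$ is the spectral norm and $\|\cdot\|_{\mathrm F}$ the Frobenius norm; $\otimes$ is the Kronecker product. Graph. $\mathcal G=(\mathcal N,\mathcal E)$ is an undirected connected graph with nodes $\mathcal N=\{1,\ldots,N\}$, of arbitrary topology; $\mathbf W$ is its $0/1$ adjacency matrix (zero diagonal) and $\mathbf L=\mathrm{diag}(\mathbf W\mathbf 1_N)-\mathbf W$ its Laplacian, with eigenvalues $\|\mathbf L\|_2=\lambda_1\ge\cdots\ge\lambda_{N-1}>\lambda_N=0$. Rate. For $\varpi\in[1/2,1)$, $\eta\in(0,2(1-\varpi))$ put $p_n=2-\eta-\gamma\lambda_n$, $q_n=\varpi\gamma\lambda_n+\eta-1$ and $$\varrho(\eta)=\max\Bigl\{\max_{n\in\mathcal N\setminus\{N\}}\tfrac12\bigl|p_n+\sqrt{p_n^2+4q_n}\bigr|,\;1-\eta\Bigr\},$$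 where $|\cdot|$ is the complex modulus and, for $x<0$, $\sqrt x=\mathrm i\sqrt{|x|}$. Data. The state space is $\mathcal S=\mathbb R^{d_s}$, the action set $\mathcal A$ is finite, $\mathbf z:\mathcal S\times\mathcal A\to\mathbb R^{d_z}$ is a given map with image $\mathcal Z$, $g:\mathcal Z\to\mathbb R$ is the one-step loss, and $\alpha>0$ is the discount factor. Node $n$ holds data $\mathcal T^{(n)}=\{(\mathbf s_i^{(n)},a_i^{(n)},g_i^{(n)},\mathbf s_i^{(n)\prime})\}_{i=1}^{N_{\rm av}^{(n)}}$, with $\mathbf s_i^{(n)\prime}=\mathbf s_{i+1}^{(n)}$, $\mathbf z_i^{(n)}=\mathbf z(\mathbf s_i^{(n)},a_i^{(n)})$, $g_i^{(n)}=g(\mathbf z_i^{(n)})$. The (random Fourier) feature map is $\varphi:\mathcal Z\to\mathbb R^D$, $\varphi(\mathbf z)=\sqrt{2/D}\,[\cos(\mathbf v_1^\top\mathbf z+u_1),\ldots,\cos(\mathbf v_D^\top\mathbf z+u_D)]^\top$, where the $\mathbf v_i\in\mathbb R^{d_z}$ and $u_i\in\mathbb R$ are (fixed) samples from the Gaussian and uniform distributions, respectively. A Q-function is identified with a vector $Q\in\mathbb R^D$ via $Q(\mathbf z)=Q^\top\varphi(\mathbf z)$. Put $\boldsymbol\Phi^{(n)}=[\varphi(\mathbf z_1^{(n)}),\ldots,\varphi(\mathbf z_{N_{\rm av}^{(n)}}^{(n)})]$, $\boldsymbol\Phi_{\mathcal N}=[\boldsymbol\Phi^{(1)},\ldots,\boldsymbol\Phi^{(N)}]$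 (so $\boldsymbol\Phi_{\mathcal N}\boldsymbol\Phi_{\mathcal N}^\top=\sum_n\boldsymbol\Phi^{(n)}\boldsymbol\Phi^{(n)\top}$ is the network-wide covariance matrix), and let $\mathbf c^{(n)}(Q)\in\mathbb R^{N_{\rm av}^{(n)}}$ have entries $c_i^{(n)}(Q)=g_i^{(n)}+\alpha\inf_{a'\in\mathcal A}Q(\mathbf z(\mathbf s_i^{(n)\prime},a'))$. Centralized Bellman mapping. With $\sigma>0$ fixed, $T_\odot:\mathbb R^D\to\mathbb R^D$, $T_\odot(Q)=\sum_{n\in\mathcal N}\bigl(\boldsymbol\Phi_{\mathcal N}\boldsymbol\Phi_{\mathcal N}^\top+\sigma\mathbf I_D\bigr)^{-1}\boldsymbol\Phi^{(n)}\mathbf c^{(n)}(Q)$. Recursion (C). On $\mathbb R^{D\times ND}$ let $A^{\rm C}(\mathfrak C)=\mathfrak C\,((\mathbf I_N-\gamma\mathbf L)\otimes\mathbf I_D)$ and $A^{\rm C}_\varpi(\mathfrak C)=\varpi A^{\rm C}(\mathfrak C)+(1-\varpi)\mathfrak C$, and let $\mathfrak C_{\mathcal N}=[\boldsymbol\Phi^{(1)}\boldsymbol\Phi^{(1)\top},\ldots,\boldsymbol\Phi^{(N)}\boldsymbol\Phi^{(N)\top}]$. Then $\mathfrak C_{-1}=\mathbf 0$, $\mathfrak C_0=A^{\rm C}_\varpi(\mathfrak C_{-1})-\eta(\mathfrak C_{-1}-N\mathfrak C_{\mathcal N})$, and for $l\in\mathbb N$, $\mathfrak C_{l+1}=\mathfrak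 C_l-(A^{\rm C}_\varpi(\mathfrak C_{l-1})-\eta\mathfrak C_{l-1})+(A^{\rm C}(\mathfrak C_l)-\eta\mathfrak C_l)$. Recursion (Q). On $\mathbb R^{D\times N}$ (elements $\mathfrak Q=[Q^{(1)},\ldots,Q^{(N)}]$) let $A^{\rm Q}(\mathfrak Q)=\mathfrak Q(\mathbf I_N-\gamma\mathbf L)$ and $A^{\rm Q}_\varpi(\mathfrak Q)=\varpi A^{\rm Q}(\mathfrak Q)+(1-\varpi)\mathfrak Q$. Given $\mathfrak Q[k]$: $\mathfrak Q_{-1}[k]=\mathfrak Q[k]$, $\mathfrak Q_0[k]=A^{\rm Q}_\varpi(\mathfrak Q_{-1}[k])-\eta(\mathfrak Q_{-1}[k]-N\,\mathbf T(\mathfrak Q[k]))$, and for $m\in\mathbb N$, $\mathfrak Q_{m+1}[k]=\mathfrak Q_m[k]-(A^{\rm Q}_\varpi(\mathfrak Q_{m-1}[k])-\eta\mathfrak Q_{m-1}[k])+(A^{\rm Q}(\mathfrak Q_m[k])-\eta\mathfrak Q_m[k])$. Distributed algorithm. Parameters: $M\in\{1,2,\ldots\}$, $J_C\in\{1,\ldots,M\}$, initial $\mathfrak Q[0]\in\mathbb R^{D\times N}$. Between two consecutive value-iteration indices $k$ and $k+1$, $M$ inner steps $m=0,\ldots,M-1$ of recursion (Q) are run, and one step of recursion (C) is run at those inner steps with $m\equiv0\pmod{J_C}$, the covariance estimates being left unchanged at the other inner steps. Hence the covariance estimate available at node $n$ at index $k$ is $\hat{\mathbf C}^{(n)}[k]=\mathbf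 C^{(n)}_{k\lceil M/J_C\rceil}$, the iterate of recursion (C) after $k\lceil M/J_C\rceil$ updates from $\mathfrak C_0$. At index $k$ the nodal bases are $\boldsymbol\Psi^{(n)}[k]=(\hat{\mathbf C}^{(n)}[k]+\sigma\mathbf I_D)^{-1}\boldsymbol\Phi^{(n)}$, the nodal Bellman mappings are $T^{(n)}(Q)=\boldsymbol\Psi^{(n)}[k]\,\mathbf c^{(n)}(Q)$ (their dependence on $k$ is suppressed in the notation), and $\mathbf T(\mathfrak Q)=[T^{(1)}(Q^{(1)}),\ldots,T^{(N)}(Q^{(N)})]\in\mathbb R^{D\times N}$, so that $\mathbf T(\mathfrak Q)\mathbf 1_N=\sum_nT^{(n)}(Q^{(n)})$. The update is $\mathfrak Q[k+1]=[Q^{(1)}[k+1],\ldots,Q^{(N)}[k+1]]=\mathfrak Q_M[k]$. *)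

(* Defs.v *)
From HB Require Import structures.
From mathcomp Require Import all_boot all_order all_algebra.
From mathcomp Require Import all_classical all_reals all_analysis.
From mathcomp Require Import complex mxtens.

Set Implicit Arguments.
Unset Strict Implicit.
Unset Printing Implicit Defensive.

Import Order.TTheory GRing.Theory Num.Theory.
Import numFieldNormedType.Exports.

Local Open Scope classical_set_scope.
Local Open Scope ring_scope.

Section Norms.
Context {R : realType}.

Definition enorm d (x : 'cV[R]_d) : R := Num.sqrt (\sum_(i < d) x i ord0 ^+ 2).

Definition fnorm m n (A : 'M[R]_(m, n)) : R :=
  Num.sqrt (\sum_(i < m) \sum_(j < n) A i j ^+ 2).

Definition spectral_norm m n (A : 'M[R]_(m, n)) : R :=
  sup [set enorm (A *m x) | x in [set x : 'cV[R]_n | enorm x <= 1]].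

End Norms.

Section Graph.
Context (R : realType) {N : nat}.

Definition connected_graph (e : rel 'I_N) : Prop :=
  [/\ symmetric e, irreflexive e & forall i j, fingraph.connect e i j].

Definition adjacency (e : rel 'I_N) : 'M[R]_N := \matrix_(i, j) (e i j)%:R.

Definition laplacian (e : rel 'I_N) : 'M[R]_N :=
  diag_mx (adjacency e *m const_mx 1 : 'cV_N)^T - adjacency e.

(* The eigenvalues with multiplicity, in nonincreasing order; the 0-based index
   n stands for node n + 1, so the last index N - 1 carries lambda_N. *)
Definition eigenvalues_desc (A : 'M[R]_N) (lambda : 'I_N -> R) : Prop :=
  char_poly A = \prod_(n < N) ('X - (lambda n)%:P) /\
  (forall i j : 'I_N, (i <= j)%N -> lambda j <= lambda i).

End Graph.

Section Rate.
Context {R : realType}.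

Definition csqrt (x : R) : R[i] :=
  if 0 <= x then (Num.sqrt x)%:C%C else (0 +i* Num.sqrt `|x|)%C.

Definition rate (N : nat) (lambda : 'I_N -> R) (gamma varpi eta : R) : R :=
  let p n := 2 - eta - gamma * lambda n in
  let q n := varpi * gamma * lambda n + eta - 1 in
  Num.max
    (\big[Num.max/0]_(n < N | (n.+1 < N)%N)
       (2^-1 * Normc.normc ((p n)%:C%C + csqrt (p n ^+ 2 + 4 * q n))))
    (1 - eta).

End Rate.

Section Recursion.
Context {R : realType} {V : lmodType R}.
Variables (A : V -> V) (varpi eta : R).

Definition relaxed (x : V) : V := varpi *: A x + (1 - varpi) *: x.

(* [rec_state x b l] is the pair (x_(l-1), x_l) of the two-term recursion
   started at x_(-1) = x, where b is N times the input to be averaged. *)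
Fixpoint rec_state (x b : V) (l : nat) : V * V :=
  if l is l'.+1 then
    let: (y, z) := rec_state x b l' in
    (z, z - (relaxed y - eta *: y) + (A z - eta *: z))
  else (x, relaxed x - eta *: (x - b)).

Definition rec_seq (x b : V) (l : nat) : V := (rec_state x b l).2.

End Recursion.

(* [nstates] and [nactions] of a node: its trajectory has one more state than
   it has samples, since s'_i = s_(i+1). The loss is only ever evaluated on the
   image of [feat], so it is represented by a total function. The [freq] and
   [phase] of the random Fourier features are arbitrary fixed values. *)
Record rl_data (R : realType) (N : nat) := RLData {
  sdim : nat;
  zdim : nat;
  fdim : nat;
  action : finType;
  feat : 'cV[R]_sdim -> action -> 'cV[R]_zdim;
  loss : 'cV[R]_zdim -> R;
  discount : R;
  nsamples : 'I_N -> nat;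
  state : forall n : 'I_N, 'I_(nsamples n).+1 -> 'cV[R]_sdim;
  act : forall n : 'I_N, 'I_(nsamples n) -> action;
  freq : 'I_fdim -> 'cV[R]_zdim;
  phase : 'I_fdim -> R }.

Section Bellman.
Context {R : realType} {N : nat}.
Variable P : rl_data R N.
Local Notation D := (fdim P).

Definition cur_state n (i : 'I_(nsamples P n)) : 'cV[R]_(sdim P) :=
  state (widen_ord (leqnSn _) i).

Definition next_state n (i : 'I_(nsamples P n)) : 'cV[R]_(sdim P) :=
  state (lift ord0 i).

Definition sample n (i : 'I_(nsamples P n)) : 'cV[R]_(zdim P) :=
  feat (cur_state i) (act i).

Definition rff (z : 'cV[R]_(zdim P)) : 'cV[R]_D :=
  \col_(i < D) (Num.sqrt (2 / D%:R) *
                cos (((freq i)^T *m z) ord0 ord0 + phase i)).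

Definition qval (Q : 'cV[R]_D) (z : 'cV[R]_(zdim P)) : R :=
  (Q^T *m rff z) ord0 ord0.

Definition Phi n : 'M[R]_(D, nsamples P n) :=
  \matrix_(j, i) rff (sample i) j ord0.

Definition PhiN : 'M[R]_(D, \sum_(n < N) nsamples P n) :=
  \mxrow_(n < N) Phi n.

Definition cvec n (Q : 'cV[R]_D) : 'cV[R]_(nsamples P n) :=
  \col_i (loss (sample i) +
          discount P * inf (range (fun a => qval Q (feat (next_state i) a)))).

Definition bellman_centralized (sigma : R) (Q : 'cV[R]_D) : 'cV[R]_D :=
  \sum_(n < N) invmx (PhiN *m PhiN^T + sigma%:M) *m Phi n *m cvec n Q.

End Bellman.

Definition contraction_with (R : realType) d (T : 'cV[R]_d -> 'cV[R]_d)
    (beta : R) : Prop :=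
  0 < beta < 1 /\
  forall Q1 Q2, enorm (T Q1 - T Q2) <= beta * enorm (Q1 - Q2).

Definition ceil_div (m d : nat) : nat := (m %/ d + ~~ (d %| m))%N.

Section Distributed.
Context {R : realType} {N : nat}.
Variables (P : rl_data R N) (e : rel 'I_N) (varpi eta sigma : R).
Local Notation D := (fdim P).
Local Notation L := (laplacian R e).

Definition step_size : R := 1 / spectral_norm L.

Definition mixing : 'M[R]_N := 1%:M - step_size *: L.

(* [mxtens_index (n, j)] is the position n * D + j, i.e. column j of block n. *)
Definition block (X : 'M[R]_(D, N * D)) (n : 'I_N) : 'M[R]_D :=
  \matrix_(i, j) X i (mxtens_index (n, j)).

Definition covN : 'M[R]_(D, N * D) :=
  \matrix_(i, k) let: (n, j) := mxtens_unindex k in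
                 (Phi P n *m (Phi P n)^T) i j.

Definition AC (X : 'M[R]_(D, N * D)) : 'M[R]_(D, N * D) :=
  X *m (mixing *t (1%:M : 'M[R]_D)).

Definition Cseq (l : nat) : 'M[R]_(D, N * D) :=
  rec_seq AC varpi eta 0 (N%:R *: covN) l.

Definition AQ (X : 'M[R]_(D, N)) : 'M[R]_(D, N) := X *m mixing.

Section Algorithm.
Variables (M JC : nat).

Definition Chat (k : nat) (n : 'I_N) : 'M[R]_D :=
  block (Cseq (k * ceil_div M JC)) n.

(* [invmx] is total: at the indices k, necessarily finitely many, where the
   estimate plus sigma I might be singular, it returns its argument. *)
Definition Psi (k : nat) (n : 'I_N) : 'M[R]_(D, nsamples P n) :=
  invmx (Chat k n + sigma%:M) *m Phi P n.

Definition bellman_nodal (k : nat) (n : 'I_N) (Q : 'cV[R]_D) : 'cV[R]_D :=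
  Psi k n *m cvec n Q.

Definition bellman_all (k : nat) (X : 'M[R]_(D, N)) : 'M[R]_(D, N) :=
  \matrix_(i, n) bellman_nodal k n (col n X) i ord0.

Definition inner_seq (k : nat) (X : 'M[R]_(D, N)) (m : nat) : 'M[R]_(D, N) :=
  rec_seq AQ varpi eta X (N%:R *: bellman_all k X) m.

Fixpoint Qiter (Q0 : 'M[R]_(D, N)) (k : nat) : 'M[R]_(D, N) :=
  if k is k'.+1 then inner_seq k' (Qiter Q0 k') M else Q0.

End Algorithm.
End Distributed.
Arguments step_size R {N} e.

(* Main.v *)
Require Import Defs.
From mathcomp Require Import all_boot all_order all_algebra.
From mathcomp Require Import all_classical all_reals all_analysis.
From mathcomp Require Import complex mxtens ring lra zify.

Set Implicit Arguments.
Unset Strict Implicit.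
Unset Printing Implicit Defensive.

Import Order.TTheory GRing.Theory Num.Theory.
Import numFieldNormedType.Exports.

Local Open Scope classical_set_scope.
Local Open Scope ring_scope.

(** The average of the columns and the deviation from it evolve separately. On
    the average both recursions act as scalar recursions with the roots [1] and
    [1 - eta], so it converges to the average of the injected data. The Laplacian
    is diagonalizable over the reals and, the graph being connected, its kernel
    consists of the constant vectors only; hence the deviation splits into scalar
    recursions [x_(l+1) = p x_l + q x_(l-1)], one for each nonzero eigenvalue,
    whose dominant root is at most the rate. A possible double root accounts for
    the factor [l].

    For (iv), the covariance estimates converge, so the nodal bases converge by
    coercivity of [Phi Phi^T + sigma I], and the nodal Q-vectors agree up to
    [O(M rho^M)]. One step of the algorithm is thus one application of the
    centralized contraction up to a perturbation [O(M rho^M) + o(1)]. *)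

(** * Norms of real matrices *)

Section SumNorm.
Context {R : realType}.

(** An entrywise norm that is submultiplicative for all shapes and dominates the Frobenius norm; it
    serves where constants depending on the dimensions are harmless. *)
Definition sumnorm m n (A : 'M[R]_(m, n)) : R :=
  \sum_(i < m) \sum_(j < n) `|A i j|.

Lemma sumnorm_ge0 m n (A : 'M[R]_(m, n)) : 0 <= sumnorm A.
Proof. by apply: sumr_ge0 => i _; apply: sumr_ge0. Qed.

Lemma entry_le_sumnorm m n (A : 'M[R]_(m, n)) i j : `|A i j| <= sumnorm A.
Proof.
rewrite /sumnorm (bigD1 i)//= (bigD1 j)//= -addrA lerDl addr_ge0//.
  exact: sumr_ge0.
by apply: sumr_ge0 => k _; apply: sumr_ge0.
Qed.

Lemma sumnormD m n (A B : 'M[R]_(m, n)) :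
  sumnorm (A + B) <= sumnorm A + sumnorm B.
Proof.
rewrite /sumnorm -big_split; apply: ler_sum => i _.
by rewrite -big_split; apply: ler_sum => j _ /=; rewrite mxE ler_normD.
Qed.

Lemma sumnormZ m n a (A : 'M[R]_(m, n)) : sumnorm (a *: A) = `|a| * sumnorm A.
Proof.
rewrite /sumnorm mulr_sumr; apply: eq_bigr => i _.
by rewrite mulr_sumr; apply: eq_bigr => j _; rewrite mxE normrM.
Qed.

Lemma sumnormM m n p (A : 'M[R]_(m, n)) (B : 'M[R]_(n, p)) :
  sumnorm (A *m B) <= sumnorm A * sumnorm B.
Proof.
rewrite /sumnorm mulr_suml; apply: ler_sum => i _.
apply: (@le_trans _ _ (\sum_(j < p) \sum_(k < n) `|A i k| * `|B k j|)).
  apply: ler_sum => j _; rewrite mxE; apply: le_trans (ler_norm_sum _ _ _) _.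
  by apply: ler_sum => k _; rewrite normrM.
rewrite exchange_big mulr_suml /=; apply: ler_sum => k _.
rewrite -mulr_sumr ler_wpM2l// (bigD1 k)//= lerDl.
by apply: sumr_ge0 => l _; apply: sumr_ge0.
Qed.

Lemma fnorm_ge0 m n (A : 'M[R]_(m, n)) : 0 <= fnorm A.
Proof. exact: sqrtr_ge0. Qed.

Lemma fnorm_le_sumnorm m n (A : 'M[R]_(m, n)) : fnorm A <= sumnorm A.
Proof.
rewrite -[leRHS](ger0_norm (sumnorm_ge0 A)) -sqrtr_sqr ler_wsqrtr//.
rewrite expr2 {1}/sumnorm mulr_suml; apply: ler_sum => i _.
rewrite mulr_suml; apply: ler_sum => j _.
by rewrite -real_normK ?num_real// expr2 ler_wpM2l// entry_le_sumnorm.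
Qed.

Lemma enorm_fnorm d (x : 'cV[R]_d) : enorm x = fnorm x.
Proof. by congr Num.sqrt; apply: eq_bigr => i _; rewrite big_ord1. Qed.

Lemma enorm_ge0 d (x : 'cV[R]_d) : 0 <= enorm x.
Proof. exact: sqrtr_ge0. Qed.

Lemma enorm_sqr d (x : 'cV[R]_d) : enorm x ^+ 2 = \sum_i x i ord0 ^+ 2.
Proof. by rewrite sqr_sqrtr// sumr_ge0// => i _; rewrite sqr_ge0. Qed.

Lemma entry_le_enorm d (x : 'cV[R]_d) i : `|x i ord0| <= enorm x.
Proof.
rewrite -sqrtr_sqr ler_wsqrtr// (bigD1 i)//= lerDl.
by apply: sumr_ge0 => j _; rewrite sqr_ge0.
Qed.

Lemma enorm0_eq0 d (x : 'cV[R]_d) : enorm x = 0 -> x = 0.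
Proof.
move=> x0; apply/matrixP => i j; rewrite ord1 mxE; apply/normr0_eq0/eqP.
by rewrite eq_le normr_ge0 andbT -x0 entry_le_enorm.
Qed.

Lemma enorm_gt0 d (x : 'cV[R]_d) : x != 0 -> 0 < enorm x.
Proof.
by move=> x0; rewrite lt_def enorm_ge0 andbT; apply: contra x0 => /eqP/enorm0_eq0 ->.
Qed.

Lemma enorm0 d : enorm (0 : 'cV[R]_d) = 0.
Proof. by rewrite /enorm big1 ?sqrtr0// => i _; rewrite mxE expr0n. Qed.

Lemma enormZ d a (x : 'cV[R]_d) : enorm (a *: x) = `|a| * enorm x.
Proof.
rewrite -sqrtr_sqr -sqrtrM ?sqr_ge0// mulr_sumr.
by congr Num.sqrt; apply: eq_bigr => i _; rewrite mxE exprMn.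
Qed.

Lemma enormN d (x : 'cV[R]_d) : enorm (- x) = enorm x.
Proof. by rewrite -scaleN1r enormZ normrN1 mul1r. Qed.

Lemma enormB d (x y : 'cV[R]_d) : enorm (x - y) = enorm (y - x).
Proof. by rewrite -enormN opprB. Qed.

Lemma cauchy_schwarz (I : finType) (f g : I -> R) :
  (\sum_i f i * g i) ^+ 2 <= (\sum_i f i ^+ 2) * (\sum_i g i ^+ 2).
Proof.
set b := \sum_i f i * g i; set a := \sum_i g i ^+ 2.
have a_ge0 : 0 <= a by apply: sumr_ge0 => i _; rewrite sqr_ge0.
(* This sum equals [a (a |f|^2 - b^2)]. It remains to divide by [a]; if [a = 0], then [g = 0]. *)
have : 0 <= \sum_i (a * f i - b * g i) ^+ 2.
  by apply: sumr_ge0 => i _; rewrite sqr_ge0.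
have -> : \sum_i (a * f i - b * g i) ^+ 2 =
    a * (a * (\sum_i f i ^+ 2) - b ^+ 2).
  transitivity (\sum_i (a ^+ 2 * f i ^+ 2 - (2 * a * b) * (f i * g i)
                        + b ^+ 2 * g i ^+ 2)).
    by apply: eq_bigr => i _; ring.
  by rewrite big_split sumrB /= -!mulr_sumr -/a -/b; ring.
have [a_gt0|] := ltP 0 a.
  by rewrite pmulr_rge0// subr_ge0 [leRHS]mulrC.
move=> a_le0 _; have a0 : a = 0 by apply/eqP; rewrite eq_le a_le0.
rewrite a0 mulr0 /b big1 ?expr0n// => i _.
have /eqP : g i ^+ 2 == 0.
  rewrite eq_le sqr_ge0 andbT -a0 /a (bigD1 i)//= lerDl.
  by apply: sumr_ge0 => j _; rewrite sqr_ge0.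
by move=> /eqP; rewrite sqrf_eq0 => /eqP ->; rewrite mulr0.
Qed.

Lemma dot_le_enorm d (x y : 'cV[R]_d) :
  `|(x^T *m y) ord0 ord0| <= enorm x * enorm y.
Proof.
rewrite -sqrtr_sqr -sqrtrM; last by apply: sumr_ge0 => i _; rewrite sqr_ge0.
rewrite ler_wsqrtr// mxE.
under eq_bigr => i _ do rewrite mxE.
exact: cauchy_schwarz.
Qed.

Lemma enormD d (x y : 'cV[R]_d) : enorm (x + y) <= enorm x + enorm y.
Proof.
rewrite -(@ler_pXn2r _ 2)// ?nnegrE ?addr_ge0 ?enorm_ge0//.
have -> : enorm (x + y) ^+ 2 =
    enorm x ^+ 2 + 2 * (x^T *m y) ord0 ord0 + enorm y ^+ 2.
  rewrite !enorm_sqr mxE mulr_sumr -!big_split; apply: eq_bigr => i _ /=.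
  by rewrite !mxE; ring.
rewrite sqrrD lerD2r lerD2l -[leRHS]mulr_natl ler_wpM2l//.
exact: le_trans (ler_norm _) (dot_le_enorm x y).
Qed.

Lemma enorm_sum d (I : Type) (r : seq I) (P : pred I) (F : I -> 'cV[R]_d) :
  enorm (\sum_(i <- r | P i) F i) <= \sum_(i <- r | P i) enorm (F i).
Proof.
elim/big_ind2 : _ => //; first by rewrite enorm0.
by move=> x a y b xa yb; apply: le_trans (enormD _ _) (lerD _ _).
Qed.

Lemma enorm_mulmx m n (A : 'M[R]_(m, n)) (x : 'cV[R]_n) :
  enorm (A *m x) <= fnorm A * enorm x.
Proof.
rewrite -sqrtrM; last first.
  by apply: sumr_ge0 => i _; apply: sumr_ge0 => j _; rewrite sqr_ge0.
rewrite ler_wsqrtr// mulr_suml; apply: ler_sum => i _.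
by rewrite mxE; apply: cauchy_schwarz.
Qed.

End SumNorm.

(** * Spectrum of the graph Laplacian *)

Section SymmetricMatrices.
Context {R : realType}.

(** The diagonal entries of [S S = S S^T] are the squared lengths of the rows of [S]. *)
Lemma symmetric_sqr_eq0 n (S : 'M[R]_n) : S^T = S -> S *m S = 0 -> S = 0.
Proof.
move=> symS /matrixP SS0; apply/matrixP => i j; rewrite [RHS]mxE.
have /eqP := SS0 i i; rewrite -{2}symS !mxE.
under eq_bigr => k _ do rewrite mxE -expr2.
rewrite psumr_eq0 => [/allP/(_ j)|k _]; last by rewrite sqr_ge0.
by rewrite mem_index_enum sqrf_eq0 => /(_ isT)/eqP.
Qed.

Lemma symmetric_exp n (S : 'M[R]_n.+1) k : S^T = S -> (S ^+ k)^T = S ^+ k.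
Proof.
move=> symS; elim: k => [|k IHk]; first by rewrite expr0 trmx1.
by rewrite {1}exprS [LHS]trmx_mul IHk symS exprSr.
Qed.

(** The exponent is first raised to [2 ^ k] and then halved [k] times, every power of [S] being
    symmetric. *)
Lemma symmetric_nilpotent n (S : 'M[R]_n.+1) k : S^T = S -> S ^+ k = 0 -> S = 0.
Proof.
move=> symS Sk0; have : S ^+ (2 ^ k) = 0.
  by rewrite -(subnK (ltnW (ltn_expl k (ltnSn 1)))) exprD Sk0 mulr0.
elim: k {Sk0} => [//|k IHk].
rewrite expnS mulnC exprM expr2 => SS0; apply: IHk.
by apply: symmetric_sqr_eq0 SS0; exact: symmetric_exp.
Qed.

Lemma symmetric_horner n (S : 'M[R]_n.+1) (p : {poly R}) :
  S^T = S -> (horner_mx S p)^T = horner_mx S p.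
Proof.
move=> symS; elim/poly_ind: p => [|p c IHp]; first by rewrite rmorph0 trmx0.
rewrite rmorphD rmorphM /= horner_mx_X horner_mx_C raddfD /= tr_scalar_mx.
congr (_ + _); rewrite [LHS]trmx_mul IHp symS.
exact/esym/comm_horner_mx/comm_mx_refl.
Qed.

Lemma char_poly_similar n (P A : 'M[R]_n) :
  P \in unitmx -> char_poly (invmx P *m A *m P) = char_poly A.
Proof.
move=> Pu; rewrite /char_poly /char_poly_mx !map_mxM.
set Pp := map_mx _ P; set Pi := map_mx _ (invmx P); set Ap := map_mx _ A.
have PiPp : Pi *m Pp = 1%:M by rewrite -map_mxM mulVmx// map_mx1.
have -> : 'X%:M - Pi *m Ap *m Pp = Pi *m ('X%:M - Ap) *m Pp.
  by rewrite mulmxBr mulmxBl mul_mx_scalar -scalemxAl PiPp scalemx1.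
by rewrite !det_mulmx mulrAC -det_mulmx PiPp det1 mul1r.
Qed.

(* The square-free part [q] of the characteristic polynomial satisfies
   [q(S)^k = 0] for some [k], and a nilpotent symmetric matrix vanishes. *)
Lemma symmetric_diagonalizable n (S : 'M[R]_n) (s : seq R) : (0 < n)%N ->
  S^T = S -> char_poly S = \prod_(x <- s) ('X - x%:P) ->
  exists2 P : 'M[R]_n, P \in unitmx &
  exists2 d : 'rV[R]_n, S = invmx P *m diag_mx d *m P &
    perm_eq [seq d ord0 i | i <- enum 'I_n] s.
Proof.
case: n S => // n S _ symS charS; pose q : {poly R} := \prod_(x <- undup s) ('X - x%:P).
have qS0 : horner_mx S q = 0.
  apply: (@symmetric_nilpotent _ _ (size s)); first exact: symmetric_horner.
  rewrite -rmorphXn /=; have /dvdpP[r ->] : char_poly S %| q ^+ size s.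
    have dvd_q t : {subset t <= s} ->
        \prod_(x <- t) ('X - x%:P) %| q ^+ size t.
      elim: t => [|x t IHt] sub_s; first by rewrite big_nil dvd1p.
      rewrite big_cons exprS dvdp_mul ?IHt//; last first.
        by move=> y yt; rewrite sub_s// inE yt orbT.
      by rewrite dvdp_XsubCl root_prod_XsubC mem_undup sub_s// mem_head.
    by rewrite charS dvd_q.
  by rewrite rmorphM /= Cayley_Hamilton mulr0.
have /diagonalizableP[P Pu] :
    exists2 rs, uniq rs & mxminpoly S %| \prod_(x <- rs) ('X - x%:P).
  by exists (undup s); [exact: undup_uniq|exact/mxminpoly_minP].
move=> /(diagonalizable_forLR Pu)[d].
rewrite mxpoly.conjumx ?unitmx_inv// invmxK => Sd; exists P => //; exists d => //.
apply: prod_XsubC_eq; rewrite -charS Sd char_poly_similar//.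
rewrite char_poly_trig ?diag_mx_is_trig// big_map big_enum.
by apply: eq_bigr => i _; rewrite mxE eqxx.
Qed.

End SymmetricMatrices.

Section Laplacian.
Context {R : realType} {N : nat}.
Variable e : rel 'I_N.
Hypothesis e_conn : connected_graph e.
Local Notation L := (laplacian R e).

Lemma laplacianE i j :
  L i j = (\sum_k (e i k)%:R) *+ (i == j) - (e i j)%:R.
Proof.
rewrite !mxE; congr (_ *+ _ - _).
by apply: eq_bigr => k _; rewrite !mxE mulr1.
Qed.

Lemma laplacian_sym : L^T = L.
Proof.
have [e_sym _ _] := e_conn; apply/matrixP => i j; rewrite mxE !laplacianE.
by rewrite (e_sym j i); have [->|] := eqVneq i j.
Qed.

Lemma laplacian_mul (x : 'cV[R]_N) i :
  (L *m x) i ord0 = \sum_j (e i j)%:R * (x i ord0 - x j ord0).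
Proof.
rewrite mxE; under eq_bigr => j _ do rewrite laplacianE mulrBl.
rewrite sumrB (bigD1 i)//= eqxx mulr1n [X in _ + X - _]big1 ?addr0; last first.
  by move=> j /negPf; rewrite eq_sym => ->; rewrite mul0r.
rewrite mulr_suml -sumrB; apply: eq_bigr => j _; exact/esym/mulrBr.
Qed.

Lemma laplacian_const1 : L *m const_mx 1 = 0 :> 'cV[R]_N.
Proof.
apply/matrixP => i j; rewrite ord1 laplacian_mul [RHS]mxE big1// => k _.
by rewrite !mxE subrr mulr0.
Qed.

(** This is the Dirichlet form of the graph. The sum runs over ordered pairs, so every edge counts
    twice; exchanging [i] and [j] symmetrizes it. *)
Lemma laplacian_quad (x : 'cV[R]_N) :
  2 * (x^T *m (L *m x)) ord0 ord0 =
  \sum_i \sum_j (e i j)%:R * (x i ord0 - x j ord0) ^+ 2.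
Proof.
have [e_sym _ _] := e_conn.
have -> : (x^T *m (L *m x)) ord0 ord0 =
    \sum_i \sum_j (e i j)%:R * (x i ord0 * (x i ord0 - x j ord0)).
  rewrite mxE; apply: eq_bigr => i _; rewrite laplacian_mul mxE mulr_sumr.
  by apply: eq_bigr => j _; ring.
rewrite mulr_natl mulr2n {2}exchange_big -big_split; apply: eq_bigr => i _ /=.
by rewrite -big_split; apply: eq_bigr => j _ /=; rewrite (e_sym j i); ring.
Qed.

(** The Dirichlet form vanishes at [x], hence so does each of its nonnegative terms: [x] agrees
    across every edge and, by connectedness, along a path between any two nodes. *)
Lemma laplacian_ker (x : 'cV[R]_N) :
  L *m x = 0 -> forall i j, x i ord0 = x j ord0.
Proof.
move=> Lx0; have [_ _ e_connect] := e_conn.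
have sq_ge0 (i j : 'I_N) : 0 <= (e i j)%:R * (x i ord0 - x j ord0) ^+ 2.
  by rewrite mulr_ge0 ?sqr_ge0.
have e_eq i j : e i j -> x i ord0 = x j ord0.
  move=> eij; apply/eqP; rewrite -subr_eq0 -sqrf_eq0 eq_le sqr_ge0 andbT.
  have := laplacian_quad x; rewrite Lx0 mulmx0 mxE mulr0 => ->.
  rewrite (bigD1 i)//= (bigD1 j)//= eij mul1r -addrA lerDl addr_ge0//.
    exact: sumr_ge0.
  by apply: sumr_ge0 => k _; apply: sumr_ge0.
move=> i j; have /connectP[p + ->] := e_connect i j.
elim: p i => [//|k p IHp] i /= /andP[/e_eq -> /IHp].
by [].
Qed.

Lemma laplacian_eigenvector a : root (char_poly L) a ->
  exists2 v : 'cV[R]_N, v != 0 & L *m v = a *: v.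
Proof.
rewrite -eigenvalue_root_char => /eigenvalueP[v vL v0].
exists v^T; first by rewrite -(inj_eq trmx_inj) trmxK trmx0.
by rewrite -[in LHS]laplacian_sym -trmx_mul vL linearZ.
Qed.

Lemma laplacian_eigenvalue_ge0 a : root (char_poly L) a -> 0 <= a.
Proof.
move=> /laplacian_eigenvector[v v0 Lv].
have : 0 <= 2 * (v^T *m (L *m v)) ord0 ord0.
  rewrite laplacian_quad; apply: sumr_ge0 => i _; apply: sumr_ge0 => j _.
  by rewrite mulr_ge0 ?sqr_ge0.
rewrite Lv -scalemxAr mxE pmulr_rge0// mxE.
under eq_bigr => k _ do rewrite mxE -expr2.
by rewrite -enorm_sqr pmulr_lge0// exprn_gt0// enorm_gt0.
Qed.

(** The set in the supremum is bounded by the Frobenius norm, and the normalized eigenvector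
    contributes the value [a]. *)
Lemma eigenvalue_le_spectral_norm a : root (char_poly L) a ->
  a <= spectral_norm L.
Proof.
move=> ra; have [v v0 Lv] := laplacian_eigenvector ra.
apply: ub_le_sup.
  exists (fnorm L) => _ [x /= x1 <-]; apply: le_trans (enorm_mulmx _ _) _.
  by rewrite ler_piMr// fnorm_ge0.
exists ((enorm v)^-1 *: v) => /=.
  by rewrite enormZ ger0_norm ?invr_ge0 ?enorm_ge0// mulVf// gt_eqF ?enorm_gt0.
rewrite -scalemxAr Lv scalerA mulrC -scalerA enormZ enormZ.
rewrite (ger0_norm (laplacian_eigenvalue_ge0 ra)) ger0_norm ?invr_ge0 ?enorm_ge0//.
by rewrite mulVf ?mulr1// gt_eqF ?enorm_gt0.
Qed.

End Laplacian.

(** * Two-term recursions *)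

Section ScalarRecursion.
Context {R : realType}.
Implicit Types p q r rho : R.

Definition order2 p q (v : nat -> R) := forall l, v l.+2 = p * v l.+1 + q * v l.

(* Up to the factor [K], the bound is that of the double root case. *)
Definition order2_bound p q rho K :=
  forall v, order2 p q v ->
  forall l, `|v l| <= K * (`|v 0%N| + `|v 1%N|) * l.+1%:R * rho ^+ l.

(** The difference [v_(l+1) - t1 v_l] is geometric with ratio [t2], which leaves a first-order
    recursion for [v] with forcing at most [w0 rho^l]. Its solution acquires the factor [l], whether
    or not the roots coincide. *)
Lemma order2_bound_real p q rho t1 t2 : p = t1 + t2 -> q = - (t1 * t2) ->
  `|t1| <= rho -> `|t2| <= rho -> 0 < rho ->
  exists2 K, 0 <= K & order2_bound p q rho K.
Proof.
move=> -> -> t1r t2r rho_gt0; exists (1 + (1 + `|t1|) / rho).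
  by rewrite addr_ge0// divr_ge0 ?addr_ge0// ltW.
move=> v v_rec; set w0 := `|v 1%N - t1 * v 0%N|.
have w_le l : `|v l.+1 - t1 * v l| <= w0 * rho ^+ l.
  elim: l => [|l IHl]; first by rewrite expr0 mulr1.
  have -> : v l.+2 - t1 * v l.+1 = t2 * (v l.+1 - t1 * v l).
    by rewrite v_rec; ring.
  by rewrite normrM exprS mulrCA ler_pM.
have v_le l : `|v l| <= (`|v 0%N| + l%:R * (w0 / rho)) * rho ^+ l.
  elim: l => [|l IHl]; first by rewrite expr0 mulr1 mul0r addr0.
  rewrite -(subrK (t1 * v l) (v l.+1)); apply: le_trans (ler_normD _ _) _.
  rewrite normrM (le_trans (lerD (w_le l) (ler_pM _ _ t1r IHl)))//.
  rewrite exprS -(natr1 l) le_eqVlt; apply/orP; left; apply/eqP; field.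
  by rewrite gt_eqF.
move=> l; apply: le_trans (v_le l) _; rewrite ler_wpM2r ?exprn_ge0 ?(ltW rho_gt0)//.
have w0_le : w0 <= (1 + `|t1|) * (`|v 0%N| + `|v 1%N|).
  apply: le_trans (ler_normB _ _) _; rewrite normrM.
  have := mulr_ge0 (normr_ge0 t1) (normr_ge0 (v 1%N)).
  by have := normr_ge0 (v 0%N); lra.
have {}w0_le : w0 / rho <= (1 + `|t1|) / rho * (`|v 0%N| + `|v 1%N|).
  by rewrite mulrAC ler_wpM2r // invr_ge0 ltW.
have l_ge0 : 0 <= l%:R :> R by [].
have := ler_wpM2l l_ge0 w0_le; rewrite -natr1.
set c := (1 + `|t1|) / rho; set V := `|v 0%N| + `|v 1%N| => lw.
have c_ge0 : 0 <= c by rewrite divr_ge0 ?addr_ge0// ltW.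
have V_ge0 : 0 <= V by rewrite addr_ge0.
have v0V : `|v 0%N| <= V by rewrite lerDl.
have := mulr_ge0 l_ge0 V_ge0; have := mulr_ge0 c_ge0 V_ge0.
by move: lw v0V; clear; lra.
Qed.

(* The form [E x x' = x'^2 - p x x' - q x^2], which is positive definite, is
   multiplied by [- q] at each step. *)
Lemma order2_bound_complex p q rho : p ^+ 2 + 4 * q < 0 ->
  - q <= rho ^+ 2 -> 0 < rho ->
  exists2 K, 0 <= K & order2_bound p q rho K.
Proof.
(* [d] is minus a quarter of the discriminant and the coefficient of [v_l^2] after completing the
   square in [E]. [K^2] compares the upper bound for [E] at the start with this lower one. *)
move=> disc_lt0 q_le rho_gt0; set d := - q - p ^+ 2 / 4.
have d_gt0 : 0 < d by rewrite /d; lra.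
set K := Num.sqrt ((1 + `|p| + `|q|) / d); exists K; first exact: sqrtr_ge0.
move=> v v_rec.
pose E l := v l.+1 ^+ 2 - p * v l * v l.+1 - q * v l ^+ 2.
have E_step l : E l.+1 = - q * E l by rewrite /E v_rec; ring.
have q_ge0 : 0 <= - q by have := sqr_ge0 p; lra.
have E_sq l : E l = (v l.+1 - p / 2 * v l) ^+ 2 + d * v l ^+ 2.
  by rewrite /E /d; field.
have E_ge l : d * v l ^+ 2 <= E l by rewrite E_sq lerDr sqr_ge0.
have E_le l : E l <= E 0%N * rho ^+ 2 ^+ l.
  elim: l => [|l IHl]; first by rewrite expr0 mulr1.
  rewrite E_step exprS mulrCA ler_pM// (le_trans _ (E_ge l))//.
  by rewrite mulr_ge0 ?sqr_ge0 ?ltW.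
set V := `|v 0%N| + `|v 1%N|.
have E0_le : E 0%N <= (1 + `|p| + `|q|) * V ^+ 2.
  have x0 := normr_ge0 (v 0%N); have x1 := normr_ge0 (v 1%N).
  have -> : (1 + `|p| + `|q|) * V ^+ 2 = V ^+ 2 + `|p| * V ^+ 2 + `|q| * V ^+ 2.
    ring.
  rewrite /E -2!addrA lerD//.
    by rewrite -real_normK ?num_real// ler_pXn2r ?nnegrE ?addr_ge0// lerDr.
  apply: lerD.
    rewrite (le_trans (ler_norm _))// normrN -mulrA normrM ler_wpM2l//.
    by rewrite normrM expr2 ler_pM// ?lerDl ?lerDr.
  rewrite (le_trans (ler_norm _))// normrN normrM ler_wpM2l// normrX.
  by rewrite ler_pXn2r ?nnegrE ?addr_ge0// lerDl.
move=> l; have V_ge0 : 0 <= V by rewrite addr_ge0.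
apply: (@le_trans _ _ (K * V * rho ^+ l)); last first.
  rewrite ler_wpM2r ?exprn_ge0 ?(ltW rho_gt0)// ler_peMr ?ler1n//.
  by rewrite mulr_ge0 ?sqrtr_ge0.
have KV_ge0 : 0 <= K * V * rho ^+ l.
  by rewrite !mulr_ge0 ?sqrtr_ge0 ?exprn_ge0 ?(ltW rho_gt0).
rewrite -(@ler_pXn2r _ 2) ?nnegrE// real_normK ?num_real// !exprMn sqr_sqrtr.
  rewrite -(ler_pM2l d_gt0) (le_trans (E_ge l))// (le_trans (E_le l))//.
  rewrite -exprM mulnC exprM.
  have -> : d * ((1 + `|p| + `|q|) / d * V ^+ 2 * (rho ^+ l) ^+ 2) =
      (1 + `|p| + `|q|) * V ^+ 2 * (rho ^+ l) ^+ 2.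
    by field; rewrite gt_eqF.
  by rewrite -exprM mulnC exprM ler_wpM2r ?exprn_ge0 ?(ltW rho_gt0).
by rewrite divr_ge0 ?(ltW d_gt0)// !addr_ge0.
Qed.

End ScalarRecursion.

(** * Characteristic roots as they enter the rate *)

Section RateTerm.
Context {R : realType}.

(* The dominant root of [t^2 = p t + q], as it occurs in [rate]. *)
Definition dominant_root (p q : R) : R :=
  2^-1 * Normc.normc ((p%:C + csqrt (p ^+ 2 + 4 * q))%C).

Lemma dominant_root_ge0disc (p q : R) : 0 <= p -> 0 <= p ^+ 2 + 4 * q ->
  dominant_root p q = (p + Num.sqrt (p ^+ 2 + 4 * q)) / 2.
Proof.
move=> p0 d0; rewrite /dominant_root /csqrt d0 -rmorphD /= expr0n addr0.
by rewrite sqrtr_sqr ger0_norm ?addr_ge0 ?sqrtr_ge0// mulrC.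
Qed.

(** The roots are complex conjugates, so their common squared modulus is their product [- q]. *)
Lemma dominant_root_lt0disc (p q : R) : p ^+ 2 + 4 * q < 0 ->
  dominant_root p q ^+ 2 = - q.
Proof.
move=> d0; rewrite /dominant_root /csqrt leNgt d0 /= addr0 add0r.
have q0 : 0 <= - q by have := sqr_ge0 p; lra.
rewrite sqr_sqrtr ?normr_ge0// ler0_norm ?ltW// exprMn sqr_sqrtr; lra.
Qed.

(** Since [p >= 0], the other real root [(p - s) / 2] is no larger in modulus, so a bound on the
    dominant root controls both. *)
Lemma dominant_root_bound (p q rho : R) : 0 <= p -> 0 < rho ->
  dominant_root p q <= rho -> exists2 K, 0 <= K & order2_bound p q rho K.
Proof.
move=> p0 rho_gt0 le_rho; have r_ge0 : 0 <= dominant_root p q.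
  by rewrite mulr_ge0// /Normc.normc; case: (_ + _) => ? ?; rewrite sqrtr_ge0.
have [d0|d0] := leP 0 (p ^+ 2 + 4 * q).
  move: le_rho; rewrite dominant_root_ge0disc// => le_rho.
  set s := Num.sqrt _ in le_rho.
  have s0 : 0 <= s := sqrtr_ge0 _.
  have ss : s ^+ 2 = p ^+ 2 + 4 * q by rewrite sqr_sqrtr.
  apply: (@order2_bound_real _ _ _ _ ((p + s) / 2) ((p - s) / 2)) => //.
  - by field.
  - have -> : q = (s ^+ 2 - p ^+ 2) / 4 by rewrite ss; field.
    by field.
  - by rewrite ger0_norm//; lra.
  - by rewrite ler_norml; apply/andP; split; lra.
apply: order2_bound_complex => //; rewrite -(dominant_root_lt0disc d0).
by rewrite ler_pXn2r ?nnegrE// ltW.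
Qed.

(* At [t = 1] the characteristic polynomial [t^2 - p t - q] equals
   [(1 - varpi) * s > 0]. *)
Lemma dominant_root_lt1 (varpi eta s : R) :
  2^-1 <= varpi < 1 -> 0 < eta < 2 * (1 - varpi) -> 0 < s <= 1 ->
  dominant_root (2 - eta - s) (varpi * s + eta - 1) < 1.
Proof.
move=> /andP[v_ge v_lt] /andP[e_gt e_lt] /andP[s_gt s_le].
set p := 2 - eta - s; set q := varpi * s + eta - 1.
have s1 : 0 < (1 - varpi) * s by rewrite mulr_gt0// subr_gt0.
have [d0|d0] := leP 0 (p ^+ 2 + 4 * q).
  rewrite dominant_root_ge0disc//; last by rewrite /p; lra.
  suff : Num.sqrt (p ^+ 2 + 4 * q) < 2 - p by lra.
  have p2 : 0 < 2 - p by rewrite /p; lra.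
  rewrite -[ltRHS](gtr0_norm p2) -sqrtr_sqr ltr_sqrt ?exprn_gt0//.
  by rewrite /p /q; nra.
rewrite -(@ltr_pXn2r _ 2) ?nnegrE//; first last.
  by rewrite mulr_ge0// /Normc.normc; case: (_ + _) => ? ?; rewrite sqrtr_ge0.
rewrite dominant_root_lt0disc// expr1n /q.
have : 0 < varpi * s by rewrite mulr_gt0//; lra.
lra.
Qed.

End RateTerm.

Section RecursionTheory.
Context {R : realType}.
Variables (varpi eta : R).

Lemma rec_state_fst (V : lmodType R) (A : V -> V) x b l :
  (rec_state A varpi eta x b l.+1).1 = rec_seq A varpi eta x b l.
Proof. by rewrite /rec_seq /=; case: rec_state. Qed.

Lemma rec_seq1 (V : lmodType R) (A : V -> V) x b :
  let y := rec_seq A varpi eta x b 0 in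
  rec_seq A varpi eta x b 1 =
  y - (relaxed A varpi x - eta *: x) + (A y - eta *: y).
Proof. by []. Qed.

Lemma rec_seqSS (V : lmodType R) (A : V -> V) x b l :
  let y := rec_seq A varpi eta x b l in
  let z := rec_seq A varpi eta x b l.+1 in
  rec_seq A varpi eta x b l.+2 =
  z - (relaxed A varpi y - eta *: y) + (A z - eta *: z).
Proof.
rewrite -rec_state_fst /rec_seq [in LHS]/rec_state -/(rec_state _ _ _ _ _ l.+1).
by case: rec_state.
Qed.

(** Each step is a linear combination of iterates and their images under [A]. In this way the matrix
    recursions descend to eigencoordinates, to averages and to single columns of the covariance
    blocks. *)
Lemma rec_seq_intertwine (V W : lmodType R) (f : V -> W)
    (A : V -> V) (A' : W -> W) x b l : linear f ->
  (forall y, f (A y) = A' (f y)) ->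
  f (rec_seq A varpi eta x b l) = rec_seq A' varpi eta (f x) (f b) l.
Proof.
move=> f_lin fA.
have fD u v : f (u + v) = f u + f v.
  by rewrite -[u in LHS]scale1r f_lin scale1r.
have f0 : f 0 = 0 by apply: (addrI (f 0)); rewrite -fD !addr0.
have fZ a u : f (a *: u) = a *: f u by rewrite -[_ *: u]addr0 f_lin f0 addr0.
have fN u : f (- u) = - f u by rewrite -scaleN1r fZ scaleN1r.
have fr u : f (relaxed A varpi u) = relaxed A' varpi (f u).
  by rewrite /relaxed fD !fZ fA.
suff [_ ->] : f (rec_state A varpi eta x b l).1 =
      (rec_state A' varpi eta (f x) (f b) l).1 /\
    f (rec_state A varpi eta x b l).2 =
      (rec_state A' varpi eta (f x) (f b) l).2 by [].
elim: l => [|l] /=; first by rewrite fD fN fZ fr fD fN.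
case: rec_state => y z; case: rec_state => y' z' /= [<- <-]; split=> //.
by rewrite !(fD, fN, fZ, fr, fA).
Qed.

(** For [A = id] the characteristic roots are [1] and [1 - eta]. The prescribed [x_0] multiplies the
    error of [x_(-1)] by [1 - eta], so the mode of the root [1] is absent. *)
Lemma rec_seq_id (V : lmodType R) (x b : V) l :
  rec_seq id varpi eta x b l - b = (1 - eta) ^+ l.+1 *: (x - b).
Proof.
have relaxed_id (y : V) : relaxed id varpi y = y.
  by rewrite /relaxed -scalerDl addrC subrK scale1r.
suff [] : (rec_state id varpi eta x b l).1 - b = (1 - eta) ^+ l *: (x - b) /\
    (rec_state id varpi eta x b l).2 - b = (1 - eta) ^+ l.+1 *: (x - b) by [].
elim: l => [|l] /=.
  rewrite relaxed_id expr0 expr1 scale1r scalerBl scale1r; split=> //.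
  by rewrite addrAC.
case: rec_state => y z /= [yE zE]; split=> //; rewrite relaxed_id.
have -> : z - (y - eta *: y) + (z - eta *: z) - b =
    (z - b) - (1 - eta) *: (y - b) + (1 - eta) *: (z - b).
  have idB (u : V) : u - eta *: u = (1 - eta) *: u.
    by rewrite scalerBl scale1r.
  rewrite !idB !scalerBr; set cy := _ *: y; set cz := _ *: z; set cb := _ *: b.
  rewrite opprB -[RHS]addrA [(cb - cy) + _]addrC subrKA [RHS]addrAC addrA.
  by rewrite [z - cy + cz]addrAC.
rewrite yE zE !scalerA -exprS subrr add0r -exprS.
by [].
Qed.

(** Where mixing is multiplication by [1 - s], the recursion reads [x_(l+1) = p x_l + q x_(l-1)].
    The input [b] enters only through [x_0 = - q x + eta b], so the bound for homogeneous recursions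
    applies. *)
Lemma rec_seq_scale_bound (s rho : R) :
  0 <= 2 - eta - s -> 0 < rho ->
  dominant_root (2 - eta - s) (varpi * s + eta - 1) <= rho ->
  exists2 K, 0 <= K & forall (x b : R^o) l,
    `|rec_seq ( *:%R (1 - s)) varpi eta x b l|
      <= K * (`|x| + `|b|) * l.+1%:R * rho ^+ l.
Proof.
set p := 2 - eta - s; set q := varpi * s + eta - 1.
move=> p_ge0 rho_gt0 /(dominant_root_bound p_ge0 rho_gt0)[K K_ge0 boundK].
exists (K * ((1 + `|p|) * (`|q| + `|eta|) + `|q|)).
  by rewrite mulr_ge0// addr_ge0// mulr_ge0// addr_ge0.
move=> x b; set v := rec_seq ( *:%R (1 - s)) varpi eta x b.
have v0 : v 0%N = - q * x + eta * b.
  rewrite /v /rec_seq /= /relaxed /GRing.scale /= /q; ring.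
have v1 : v 1%N = p * v 0%N + q * x.
  by rewrite /v rec_seq1 /relaxed /GRing.scale /= /p /q; ring.
have v_rec : order2 p q v.
  by move=> l; rewrite /v rec_seqSS /relaxed /GRing.scale /= /p /q; ring.
have v0_le : `|v 0%N| <= (`|q| + `|eta|) * (`|x| + `|b|).
  rewrite v0 (le_trans (ler_normD _ _))// !normrM normrN.
  have := mulr_ge0 (normr_ge0 q) (normr_ge0 b).
  by have := mulr_ge0 (normr_ge0 eta) (normr_ge0 x); lra.
have v1_le : `|v 1%N| <= `|p| * `|v 0%N| + `|q| * (`|x| + `|b|).
  rewrite v1 (le_trans (ler_normD _ _))// !normrM lerD2l ler_wpM2l//.
  by rewrite lerDl.
have v01_le : `|v 0%N| + `|v 1%N| <=
    ((1 + `|p|) * (`|q| + `|eta|) + `|q|) * (`|x| + `|b|).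
  have := ler_wpM2l (normr_ge0 p) v0_le; lra.
move=> l; apply: le_trans (boundK _ v_rec l) _.
rewrite ler_wpM2r ?exprn_ge0 ?(ltW rho_gt0)// ler_wpM2r// -mulrA.
exact: ler_wpM2l.
Qed.

End RecursionTheory.

(** * The Laplacian eigenbasis matched with the ordered eigenvalues *)

Section Spectrum.
Context {R : realType} {N : nat}.
Variables (e : rel 'I_N) (lambda : 'I_N -> R).
Hypotheses (e_conn : connected_graph e).
Hypothesis lambda_eig : eigenvalues_desc (laplacian R e) lambda.
Local Notation L := (laplacian R e).

Lemma root_lambda j : root (char_poly L) (lambda j).
Proof.
have [-> _] := lambda_eig; rewrite /root horner_prod prodf_seq_eq0.
by apply/hasP; exists j; rewrite ?mem_index_enum// hornerXsubC subrr eqxx.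
Qed.

(** The columns of [invmx P] form an eigenbasis. Those for the eigenvalue [0] are constant, and
    every other eigenvalue occurs among the indices over which the rate takes its maximum. *)
Lemma laplacian_diagonalization : (0 < N)%N ->
  exists2 P : 'M[R]_N, P \in unitmx &
  exists d : 'rV[R]_N, [/\ L *m invmx P = invmx P *m diag_mx d,
    forall n, d ord0 n = 0 -> forall i j, invmx P i n = invmx P j n,
    forall n, d ord0 n != 0 ->
      exists2 j : 'I_N, (j.+1 < N)%N & d ord0 n = lambda j
  & forall j : 'I_N, (j.+1 < N)%N -> 0 < lambda j].
Proof.
have [charL lambda_mono] := lambda_eig; move=> N_gt0.
have [P Pu [d LE perm_d]] : exists2 P : 'M[R]_N, P \in unitmx &
  exists2 d : 'rV[R]_N, L = invmx P *m diag_mx d *m P &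
    perm_eq [seq d ord0 i | i <- enum 'I_N] [seq lambda i | i <- enum 'I_N].
  apply: symmetric_diagonalizable => //; first exact: laplacian_sym.
  by rewrite big_map big_enum.
exists P => //; exists d.
have LPi : L *m invmx P = invmx P *m diag_mx d.
  by rewrite LE -!mulmxA mulmxV// mulmx1.
have col0 n : d ord0 n = 0 -> forall i j, invmx P i n = invmx P j n.
  move=> dn0 i j.
  have Lc0 : L *m col n (invmx P) = 0.
    rewrite colE mulmxA LPi -colE.
    apply/matrixP => k l; rewrite !mxE big1// => m _; rewrite mxE.
    by have [->|_] := eqVneq m n; rewrite ?dn0 ?mul0rn ?mulr0n mulr0.
  by have := laplacian_ker e_conn Lc0 i j; rewrite !mxE.
pose jmax : 'I_N := Ordinal (etrans (ltn_predL N) N_gt0).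
have jmaxP (j : 'I_N) : (j.+1 < N)%N = (j != jmax).
  by rewrite -val_eqE /=; have := ltn_ord j; lia.
(* Two kernel columns would both be constant, so the entries of [P *m invmx P] in them are products
   [S k * invmx P l l]. These equal [1] at [(n, n)] and [(m, m)] and thus cannot vanish at
   [(n, m)]. *)
have one_zero : (#|[pred i | d ord0 i == 0%R]| <= 1)%N.
  rewrite leqNgt; apply/negP => /card_gt1P[n [m [/eqP dn /eqP dm nm]]].
  pose S k := \sum_i P k i.
  have PPi k l : d ord0 l = 0 -> (k == l)%:R = S k * invmx P l l.
    move=> dl; have /matrixP/(_ k l) := mulmxV Pu; rewrite !mxE => <-.
    by rewrite mulr_suml; apply: eq_bigr => i _; rewrite (col0 l dl i l).
  have /esym/eqP := PPi n m dm; rewrite (negPf nm) mulf_eq0 => /orP[]/eqP z.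
    by have := PPi n n dn; rewrite z mul0r eqxx => /eqP; rewrite oner_eq0.
  by have := PPi m m dm; rewrite z mulr0 eqxx => /eqP; rewrite oner_eq0.
have card_zero : #|[pred i | d ord0 i == 0%R]| = #|[pred i | lambda i == 0%R]|.
  have /permP/(_ (pred1 0)) := perm_d; rewrite !count_map => cnt.
  by rewrite !cardE -!size_filter in cnt *.
have lambda_gt0 (j : 'I_N) : (j.+1 < N)%N -> 0 < lambda j.
  rewrite jmaxP => j_max; have lj_ge0 : 0 <= lambda j.
    by rewrite (laplacian_eigenvalue_ge0 e_conn)// root_lambda.
  rewrite lt_def lj_ge0 andbT; apply/eqP => lj0.
  have lmax0 : lambda jmax == 0.
    rewrite eq_le (laplacian_eigenvalue_ge0 e_conn) ?root_lambda// andbT.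
    by rewrite -lj0 lambda_mono//= -ltnS prednK.
  move: one_zero; rewrite card_zero leqNgt => /negP; apply.
  by apply/card_gt1P; exists j, jmax; rewrite !inE lj0 eqxx.
have lambda_max : lambda jmax = 0.
  have : root (char_poly L) 0.
    rewrite -eigenvalue_root_char; apply/eigenvalueP; exists (const_mx 1).
      rewrite scale0r -[LHS]trmxK trmx_mul trmx_const (laplacian_sym e_conn).
      by rewrite laplacian_const1 trmx0.
    by apply/eqP => /rowP/(_ jmax)/eqP; rewrite !mxE oner_eq0.
  rewrite charL /root horner_prod prodf_seq_eq0 => /hasP[j _ /=].
  rewrite hornerXsubC sub0r oppr_eq0 => /eqP lj0.
  have [<-//|] := eqVneq j jmax; rewrite -jmaxP => /lambda_gt0.
  by rewrite lj0 ltxx.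
split=> //.
- move=> n dn0; have : d ord0 n \in [seq lambda i | i <- enum 'I_N].
    by rewrite -(perm_mem perm_d) map_f// mem_enum.
  case/mapP => j _ dnE; exists j => //; rewrite jmaxP.
  by apply: contra_neq dn0; rewrite dnE => ->.
Qed.

End Spectrum.

(** * Convergence to the average *)

Section Consensus.
Context {R : realType} {N : nat}.
Variables (e : rel 'I_N) (lambda : 'I_N -> R) (varpi eta : R).
Hypotheses (N_gt1 : (1 < N)%N) (e_conn : connected_graph e).
Hypothesis lambda_eig : eigenvalues_desc (laplacian R e) lambda.
Hypotheses (varpi_bd : 2^-1 <= varpi < 1) (eta_bd : 0 < eta < 2 * (1 - varpi)).
Local Notation L := (laplacian R e).
Local Notation gamma := (step_size R e).
Local Notation W := (mixing e : 'M[R]_N).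
Local Notation rho := (rate lambda gamma varpi eta).

(** Every eigenvalue is at most the spectral norm, whose inverse is the step size. The last index is
    excluded because its eigenvalue is [0]. *)
Lemma scaled_eigenvalue_bound (j : 'I_N) : (j.+1 < N)%N -> 0 < gamma * lambda j <= 1.
Proof.
move=> jN; have [P _ [d [_ _ _ lambda_gt0]]] :=
  laplacian_diagonalization e_conn lambda_eig (ltnW N_gt1).
have le_norm := eigenvalue_le_spectral_norm e_conn (root_lambda lambda_eig j).
have norm_gt0 : 0 < spectral_norm L by apply: lt_le_trans le_norm; exact: lambda_gt0.
rewrite /step_size div1r mulr_gt0 ?invr_gt0 ?lambda_gt0//=.
by rewrite mulrC ler_pdivrMr// mul1r.
Qed.

Lemma eta_lt1 : eta < 1.
Proof. by move: varpi_bd eta_bd => /andP[? ?] /andP[? ?]; lra. Qed.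

Lemma rateE : rho = Num.max
  (\big[Num.max/0]_(n < N | (n.+1 < N)%N)
     dominant_root (2 - eta - gamma * lambda n)
                   (varpi * (gamma * lambda n) + eta - 1)) (1 - eta).
Proof. by congr Num.max; apply: eq_bigr => n _; rewrite /dominant_root mulrA. Qed.

Lemma rate_gt0_lt1 : 0 < rho < 1.
Proof.
have eta1 := eta_lt1; have /andP[eta_gt0 _] := eta_bd.
rewrite rateE lt_max gt_max subr_gt0 eta1 orbT /=; apply/andP; split; last lra.
apply: bigmax_lt => // j jN; apply: dominant_root_lt1 => //.
exact: scaled_eigenvalue_bound.
Qed.

Lemma rate_ge_eta : 1 - eta <= rho.
Proof. by rewrite rateE le_max lexx orbT. Qed.

Lemma rate_ge_root (j : 'I_N) : (j.+1 < N)%N ->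
  dominant_root (2 - eta - gamma * lambda j)
                (varpi * (gamma * lambda j) + eta - 1) <= rho.
Proof. by move=> jN; rewrite rateE le_max (le_bigmax_cond _ _ jN). Qed.

Local Notation J := (const_mx N%:R^-1 : 'M[R]_N).

Lemma average_outer :
  J = (const_mx 1 : 'cV_N) *m (const_mx N%:R^-1 : 'rV_N).
Proof. by apply/matrixP => i j; rewrite !mxE big_ord1 !mxE mul1r. Qed.

Lemma laplacian_average : L *m J = 0.
Proof. by rewrite average_outer mulmxA (laplacian_const1 e) mul0mx. Qed.

Lemma average_laplacian : J *m L = 0.
Proof.
by rewrite -[LHS]trmxK trmx_mul laplacian_sym// trmx_const laplacian_average trmx0.
Qed.

Lemma mixing_average : W *m J = J.
Proof. by rewrite mulmxBl mul1mx -scalemxAl laplacian_average scaler0 subr0. Qed.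

(** The error splits into [X_l J - B J], governed by the recursion for [A = id], and [X_l (1 - J)],
    expanded in eigencoordinates. [K] is chosen before [D], [X] and [B], so it depends only on the
    graph and the parameters. *)
Lemma consensus : exists2 K, 0 <= K &
  forall D (X B : 'M[R]_(D, N)) i n l,
  `|(rec_seq (mulmxr (W)) varpi eta X B l - B *m J) i n|
  <= K * (sumnorm X + sumnorm B) * l.+1%:R * rho ^+ l.
Proof.
have /andP[rho_gt0 rho_lt1] := rate_gt0_lt1.
have [P Pu [d [LPi col0 dlambda _]]] :=
  laplacian_diagonalization e_conn lambda_eig (ltnW N_gt1).
have N_neq0 : N%:R != 0 :> R by rewrite pnatr_eq0 -lt0n ltnW.
(* The eigenbasis with column means removed: its columns still satisfy the eigenvector equations of
   [L], and [G P = 1 - J]. *)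
pose G := (1%:M - J) *m invmx P.
have LG : L *m G = G *m diag_mx d.
  rewrite /G mulmxA mulmxBr mulmx1 laplacian_average subr0 -mulmxA -LPi.
  have proj_L : (1%:M - J) *m L = L.
    by rewrite mulmxBl mul1mx average_laplacian subr0.
  by rewrite mulmxA proj_L.
have mixG : W *m G = G *m diag_mx (\row_n (1 - gamma * d ord0 n)).
  rewrite mulmxBl mul1mx -scalemxAl LG !mul_mx_diag.
  by apply/matrixP => i j; rewrite !mxE; ring.
pose f D (i : 'I_D) n (Y : 'M[R]_(D, N)) : R^o := (Y *m G) i n.
have f_lin D i n : linear (@f D i n).
  by move=> a u v; rewrite /f mulmxDl -scalemxAl !mxE.
have fmix D i n (Y : 'M[R]_(D, N)) :
    f D i n (Y *m W) = (1 - gamma * d ord0 n) *: (f D i n Y).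
  rewrite /f -mulmxA mixG mulmxA mul_mx_diag !mxE mulrC//.
have f_le D i n (Y : 'M[R]_(D, N)) : `|f D i n Y| <= sumnorm Y * sumnorm G.
  exact: le_trans (entry_le_sumnorm _ _ _) (sumnormM _ _).
have /fin_all_exists2[K K_ge0 boundK] : forall n, exists2 Kn, 0 <= Kn &
    forall D i (X B : 'M[R]_(D, N)) l,
    `|f D i n (rec_seq (mulmxr (W)) varpi eta X B l)|
      <= Kn * (`|f D i n X| + `|f D i n B|) * l.+1%:R * rho ^+ l.
  move=> n; have [dn0|dn_neq0] := eqVneq (d ord0 n) 0.
    (* A kernel column is constant, so removing its mean annihilates it and this coordinate carries
       no error. *)
    have G0 i : G i n = 0.
      rewrite /G mulmxBl mul1mx !mxE.
      under eq_bigr => k _ do rewrite mxE (col0 n dn0 k i).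
      by rewrite sumr_const card_ord -mulrnAl -[_ *+ N]mulr_natr mulVf// mul1r subrr.
    exists 0 => // D i X B l; rewrite !mul0r /f mxE big1 ?normr0// => k _.
    by rewrite G0 mulr0.
  have [j jN dnE] := dlambda n dn_neq0.
  have [||K K_ge0 boundK] := @rec_seq_scale_bound _ varpi eta
    (gamma * lambda j) rho _ _ (rate_ge_root jN).
  - have /andP[_ s_le1] := scaled_eigenvalue_bound jN.
    have := eta_lt1; lra.
  - by [].
  exists K => // D i X B l.
  rewrite (rec_seq_intertwine _ _ _ _ _ (f_lin D i n) (fmix D i n)) dnE.
  exact: boundK.
have G_ge0 := sumnorm_ge0 G; have P_ge0 := sumnorm_ge0 P.
have J_ge0 := sumnorm_ge0 J.
have sumK_ge0 : 0 <= \sum_k K k by exact: sumr_ge0.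
exists (sumnorm J + sumnorm G * (\sum_k K k) * sumnorm P).
  by rewrite addr_ge0// !mulr_ge0.
move=> D X B i n l; set Xl := rec_seq _ _ _ _ _ _.
have XlJ : Xl *m J - B *m J = (1 - eta) ^+ l.+1 *: (X *m J - B *m J).
  rewrite -(rec_seq_id varpi eta (X *m J)); congr (_ - _).
  apply: (@rec_seq_intertwine _ _ _ _ _ (mulmxr J)).
    by move=> a u v; rewrite /= mulmxDl scalemxAl.
  by move=> Y /=; rewrite -mulmxA mixing_average.
have -> : Xl - B *m J = (1 - eta) ^+ l.+1 *: ((X - B) *m J) + (Xl *m G) *m P.
  have GP : G *m P = 1%:M - J by rewrite /G mulmxKV.
  rewrite [(X - B) *m J]mulmxBl -XlJ -(mulmxA Xl) GP mulmxBr mulmx1.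
  by rewrite [RHS]addrC [RHS]addrA subrK.
have eta1 := eta_lt1; have /andP[eta_gt0 _] := eta_bd.
have rl_ge0 : 0 <= rho ^+ l by rewrite exprn_ge0 ?(ltW rho_gt0).
set S := sumnorm X + sumnorm B.
have S_ge0 : 0 <= S by rewrite addr_ge0 ?sumnorm_ge0.
have mean_part : `|((1 - eta) ^+ l.+1 *: ((X - B) *m J)) i n|
    <= sumnorm J * S * rho ^+ l.
  rewrite mxE normrM mulrC ler_pM//.
    apply: le_trans (entry_le_sumnorm _ _ _) (le_trans (sumnormM _ _) _).
    rewrite mulrC ler_wpM2l// (le_trans (sumnormD _ _))//.
    by rewrite -[- B]scaleN1r sumnormZ normrN1 mul1r.
  rewrite normrX ger0_norm ?subr_ge0 ?(ltW eta1)// exprS.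
  apply: (@le_trans _ _ (1 * (1 - eta) ^+ l)).
    by rewrite ler_wpM2r ?exprn_ge0 ?subr_ge0 ?(ltW eta1)// gerBl ltW.
  rewrite mul1r lerXn2r ?nnegrE ?subr_ge0 ?(ltW eta1) ?(ltW rho_gt0)//.
  exact: rate_ge_eta.
have deviation_part : `|(Xl *m G *m P) i n|
    <= sumnorm G * (\sum_k K k) * sumnorm P * S * l.+1%:R * rho ^+ l.
  rewrite mxE (le_trans (ler_norm_sum _ _ _))//.
  apply: (@le_trans _ _
    (\sum_k K k * (sumnorm G * sumnorm P * S * l.+1%:R * rho ^+ l))).
    apply: ler_sum => k _; rewrite normrM.
    apply: le_trans (ler_pM _ _ (boundK k D i X B l) (entry_le_sumnorm P k n)) _ => //.
    have := lerD (f_le D i k X) (f_le D i k B); rewrite -mulrDl -/S => fS.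
    set A := _ + _ in fS *; set r := rho ^+ l in rl_ge0 *.
    have -> : K k * A * l.+1%:R * r * sumnorm P =
        K k * l.+1%:R * r * sumnorm P * A by ring.
    have -> : K k * (sumnorm G * sumnorm P * S * l.+1%:R * r) =
        K k * l.+1%:R * r * sumnorm P * (S * sumnorm G) by ring.
    by rewrite ler_wpM2l// !mulr_ge0.
  by rewrite -mulr_suml le_eqVlt; apply/orP; left; apply/eqP; ring.
rewrite mxE (le_trans (ler_normD _ _))// (le_trans (lerD mean_part deviation_part))//.
rewrite mulrDl !mulrDl lerD2r ler_wpM2r// ler_peMr ?ler1n//.
exact: mulr_ge0.
Qed.

End Consensus.

(** * Consensus for the nodal Q-vectors and the covariance blocks *)

Section ConsensusCorollaries.
Context {R : realType} {N : nat}.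
Variables (e : rel 'I_N) (lambda : 'I_N -> R) (varpi eta : R).
Hypotheses (N_gt1 : (1 < N)%N) (e_conn : connected_graph e).
Hypothesis lambda_eig : eigenvalues_desc (laplacian R e) lambda.
Hypotheses (varpi_bd : 2^-1 <= varpi < 1) (eta_bd : 0 < eta < 2 * (1 - varpi)).
Local Notation W := (mixing e : 'M[R]_N).
Local Notation rho := (rate lambda (step_size R e) varpi eta).

(** The factor [N] of the input cancels the [1 / N] of the average, which becomes the network-wide
    sum. *)
Lemma mulmx_scaled_averageE D (T : 'M[R]_(D, N)) i n :
  ((N%:R *: T) *m (const_mx N%:R^-1 : 'M[R]_N)) i n = \sum_k T i k.
Proof.
have N_neq0 : N%:R != 0 :> R by rewrite pnatr_eq0 -lt0n ltnW.
by rewrite mxE; apply: eq_bigr => k _; rewrite !mxE mulrAC mulfV// mul1r.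
Qed.

Lemma consensus_col : exists2 K, 0 <= K &
  forall D (X T : 'M[R]_(D, N)) n l,
  enorm (col n (rec_seq (mulmxr W) varpi eta X (N%:R *: T) l)
         - T *m const_mx 1)
  <= D%:R * K * (sumnorm X + sumnorm T) * l.+1%:R * rho ^+ l.
Proof.
have [K K_ge0 boundK] := consensus N_gt1 e_conn lambda_eig varpi_bd eta_bd.
have /andP[rho_gt0 _] := rate_gt0_lt1 N_gt1 e_conn lambda_eig varpi_bd eta_bd.
exists (K * N%:R) => [|D X T n l]; first by rewrite mulr_ge0.
rewrite enorm_fnorm (le_trans (fnorm_le_sumnorm _))//.
set c := K * (sumnorm X + sumnorm (N%:R *: T)) * l.+1%:R * rho ^+ l.
apply: (@le_trans _ _ (\sum_(i < D) c)).
  apply: ler_sum => i _; rewrite big_ord1.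
  have -> : (col n (rec_seq (mulmxr W) varpi eta X (N%:R *: T) l)
      - T *m const_mx 1) i ord0 =
    (rec_seq (mulmxr W) varpi eta X (N%:R *: T) l
      - (N%:R *: T) *m const_mx N%:R^-1) i n.
    rewrite [LHS]mxE [RHS]mxE [in LHS]mxE; congr (_ + _).
    rewrite [LHS]mxE [RHS]mxE mulmx_scaled_averageE; congr (- _).
    by rewrite mxE; apply: eq_bigr => k _; rewrite mxE mulr1.
  exact: boundK.
rewrite sumr_const card_ord -[_ *+ D]mulr_natl /c !mulrA.
rewrite ler_wpM2r ?exprn_ge0 ?(ltW rho_gt0)// ler_wpM2r//.
rewrite -!mulrA !ler_wpM2l// sumnormZ normr_nat mulrDr lerD2r.
by rewrite ler_peMl ?sumnorm_ge0// ler1n ltnW.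
Qed.

Variable P : rl_data R N.
Local Notation D := (fdim P).

Lemma cov_sum : PhiN P *m (PhiN P)^T = \sum_n Phi P n *m (Phi P n)^T.
Proof. by rewrite /PhiN tr_mxrow mul_mxrow_mxcol. Qed.

(** On a slice the Kronecker factor [I_D] disappears, so the covariance recursion splits into [D]
    independent recursions on matrices with one column per node. *)
Definition slice (j : 'I_D) (X : 'M[R]_(D, N * D)) : 'M[R]_(D, N) :=
  \matrix_(i, n) X i (mxtens_index (n, j)).

Lemma slice_covN j i k : slice j (covN P) i k = (Phi P k *m (Phi P k)^T) i j.
Proof.
rewrite mxE [LHS]mxE.
have := mxtens_indexK (k, j); case: (mxtens_unindex _) => k' j' [-> ->].
by [].
Qed.

Lemma slice_linear j : linear (slice j).
Proof. by move=> a u v; apply/matrixP => i n; rewrite !mxE. Qed.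

Lemma slice_AC j X : slice j (Defs.AC e X) = mulmxr W (slice j X).
Proof.
apply/matrixP => i n; rewrite !mxE.
rewrite (reindex (@mxtens_index N D)) /=; last first.
  by exists (@mxtens_unindex N D) => ? _; rewrite (mxtens_indexK, mxtens_unindexK).
rewrite (eq_bigr (fun p : 'I_N * 'I_D => X i (mxtens_index (p.1, p.2)) *
    (W p.1 n * (1%:M : 'M[R]_D) p.2 j))); last by move=> [k j'] _; rewrite tensmxE.
rewrite -(pair_bigA _ (fun k j' => X i (mxtens_index (k, j')) *
    (W k n * (1%:M : 'M[R]_D) j' j))) /=.
apply: eq_bigr => k _; rewrite (bigD1 j)//= big1 ?addr0.
  by rewrite !mxE eqxx mulr1.
by move=> j' /negPf j'j; rewrite [_%:M _ _]mxE j'j !mulr0.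
Qed.

Lemma covariance_consensus : exists2 K, 0 <= K & forall n l,
  fnorm (block (Cseq P e varpi eta l) n - PhiN P *m (PhiN P)^T)
  <= K * l.+1%:R * rho ^+ l.
Proof.
have [K K_ge0 boundK] := consensus N_gt1 e_conn lambda_eig varpi_bd eta_bd.
pose c j := sumnorm (slice j 0) + sumnorm (slice j (N%:R *: covN P)).
have c_ge0 j : 0 <= c j by rewrite addr_ge0 ?sumnorm_ge0.
exists (\sum_(i < D) \sum_(j < D) K * c j).
  by apply: sumr_ge0 => i _; apply: sumr_ge0 => j _; rewrite mulr_ge0.
move=> n l; apply: le_trans (fnorm_le_sumnorm _) _.
rewrite !mulr_suml; apply: ler_sum => i _.
apply: ler_sum => j _.
have -> : (block (Cseq P e varpi eta l) n - PhiN P *m (PhiN P)^T) i j =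
  (rec_seq (mulmxr W) varpi eta (slice j 0) (slice j (N%:R *: covN P)) l
   - slice j (N%:R *: covN P) *m const_mx N%:R^-1) i n.
  rewrite [LHS]mxE [RHS]mxE; congr (_ + _).
    by rewrite -(rec_seq_intertwine _ _ _ _ _ (slice_linear j) (slice_AC j)) !mxE.
  rewrite [LHS]mxE [RHS]mxE; congr (- _).
  have -> : slice j (N%:R *: covN P) = N%:R *: slice j (covN P).
    by apply/matrixP => ? ?; rewrite !mxE.
  rewrite mulmx_scaled_averageE cov_sum summxE; apply: eq_bigr => k _.
  by rewrite slice_covN.
exact: boundK.
Qed.

Lemma eqO_linear_geometric (f : nat -> R) K r : 0 <= K -> 0 <= r ->
  (forall l, 0 <= f l <= K * l.+1%:R * r ^+ l) ->
  f =O_\oo (fun l : nat => l%:R * r ^+ l).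
Proof.
(* The comparison function vanishes at [0], so the bound starts at [1], where [l + 1 <= 2 l]. The
   added [1] keeps the constant positive. *)
move=> K_ge0 r_ge0 f_le; apply/eqO_exP; exists (2 * K + 1); first by lra.
exists 1%N => // l /= l_gt0; have /andP[fl_ge0 fl_le] := f_le l.
rewrite !ger0_norm ?mulr_ge0 ?exprn_ge0// (le_trans fl_le)// mulrA.
rewrite ler_wpM2r ?exprn_ge0// -natr1.
have l1 : 1 <= l%:R :> R by rewrite ler1n.
by have := ler_wpM2l K_ge0 l1; lra.
Qed.

End ConsensusCorollaries.

(** * Perturbed contractions *)

Section Sequences.
Context {R : realType}.

Lemma geometric_small (K r eps : R) : 0 <= r < 1 -> 0 < eps ->
  exists L, forall l, (L <= l)%N -> K * r ^+ l < eps.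
Proof.
move=> /andP[r_ge0 r_lt1] eps_gt0.
have r_norm : `|r| < 1 by rewrite ger0_norm.
have [L _ HL] := (cvgrPdist_lt _ _).1 (cvg_geometric K r_norm) _ eps_gt0.
exists L => l Ll; have := HL l Ll.
by rewrite /= sub0r normrN; apply: le_lt_trans; exact: ler_norm.
Qed.

(** Each of [1, s, ..., s^l] is at least [s^l], and their sum times [1 - s] is [1 - s^(l+1)]. *)
Lemma linear_geometric_le (s : R) l : 0 <= s < 1 ->
  l.+1%:R * s ^+ l * (1 - s) <= 1.
Proof.
move=> /andP[s_ge0 s_lt1].
suff : l.+1%:R * s ^+ l * (1 - s) <= 1 - s ^+ l.+1.
  by move/le_trans; apply; rewrite gerBl exprn_ge0.
elim: l => [|l IHl]; first by rewrite expr0 expr1 !mul1r.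
have sl_le1 : s ^+ l.+1 <= 1 by rewrite exprn_ile1// ltW.
have := ler_wpM2l s_ge0 IHl; rewrite -[l.+2%:R]natr1 !exprS.
rewrite exprS in sl_le1.
have : (1 - s * s ^+ l) * (1 - s) >= 0 by rewrite mulr_ge0// subr_ge0 ?(ltW s_lt1).
lra.
Qed.

(** With [r = s^2], one factor [s^l] absorbs [l + 1] and the other tends to [0]. *)
Lemma linear_geometric_small (K r eps : R) : 0 <= K -> 0 <= r < 1 -> 0 < eps ->
  exists L, forall l, (L <= l)%N -> K * l.+1%:R * r ^+ l < eps.
Proof.
move=> K_ge0 /andP[r_ge0 r_lt1] eps_gt0; set s := Num.sqrt r.
have s_bd : 0 <= s < 1 by rewrite sqrtr_ge0 -sqrtr1 ltr_sqrt.
have /andP[s_ge0 s_lt1] := s_bd.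
have [L HL] := geometric_small (K / (1 - s)) s_bd eps_gt0.
exists L => l /HL; apply: le_lt_trans.
have -> : r ^+ l = s ^+ l * s ^+ l by rewrite -exprMn -expr2 sqr_sqrtr.
rewrite mulrA ler_wpM2r ?exprn_ge0// -mulrA ler_wpM2l// -div1r.
by rewrite ler_pdivlMr ?subr_gt0// linear_geometric_le.
Qed.

(** [c / (1 - beta)] is the fixed point of [a |-> beta a + c]. A slack of [eps / 2] times [1 - beta]
    moves it by [eps / 2], and the excess over the moved point contracts by [beta]. *)
Lemma limn_esup_contraction (a : nat -> R) (beta c : R) :
  0 < beta < 1 ->
  (forall eps, 0 < eps -> exists k0, forall k, (k0 <= k)%N ->
    a k.+1 <= beta * a k + c + eps) ->
  (limn_esup (fun k => (a k)%:E) <= (c / (1 - beta))%:E)%E.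
Proof.
move=> /andP[beta_gt0 beta_lt1] a_step; set l := c / (1 - beta).
have beta1 : 0 < 1 - beta by rewrite subr_gt0.
have lE : l * (1 - beta) = c by rewrite /l divfK// gt_eqF.
apply/lee_addgt0Pr => eps eps_gt0.
have [|k0 Hk0] := a_step (eps / 2 * (1 - beta)).
  by rewrite mulr_gt0// divr_gt0.
have iter_le j : a (k0 + j)%N - l - eps / 2 <= `|a k0 - l - eps / 2| * beta ^+ j.
  elim: j => [|j IHj]; first by rewrite addn0 expr0 mulr1 ler_norm.
  have := Hk0 _ (leq_addr j k0); have := ler_wpM2l (ltW beta_gt0) IHj.
  by rewrite addnS exprS; nra.
have beta_bd : 0 <= beta < 1 by rewrite ltW.
have eps2 : 0 < eps / 2 by rewrite divr_gt0.
have [j0 Hj0] := geometric_small `|a k0 - l - eps / 2| beta_bd eps2.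
apply: (@le_trans _ _ (ereal_sup ((fun k => (a k)%:E) @` [set k | (k0 + j0 <= k)%N]))).
  by apply: ereal_inf_lbound; exists [set k | (k0 + j0 <= k)%N] => //; exists (k0 + j0)%N.
apply: ge_ereal_sup => _ [k /= kP <-]; rewrite -EFinD lee_fin.
have kE : (k0 + (k - k0))%N = k by rewrite subnKC// (leq_trans _ kP)// leq_addr.
have := iter_le (k - k0)%N; rewrite kE => /le_lt_trans/(_ (Hj0 _ _)).
have -> : (j0 <= k - k0)%N by lia.
by move=> /(_ isT); lra.
Qed.

End Sequences.

Section FixedPoint.
Context {R : realType} {d : nat}.
Variables (T : 'cV[R]_d -> 'cV[R]_d) (beta : R).
Hypothesis T_contr : contraction_with T beta.

(** Banach iteration from [0], carried out entrywise: the increments of each entry are dominated by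
    a geometric series. *)
Lemma contraction_fixed_point : exists Q, T Q = Q.
Proof.
have [beta_bd T_lip] := T_contr; have /andP[beta_gt0 beta_lt1] := beta_bd.
pose x k := iter k T 0; set c := enorm (T 0 - 0).
have x_step k : enorm (x k.+1 - x k) <= c * beta ^+ k.
  elim: k => [|k IHk]; first by rewrite expr0 mulr1.
  by apply: le_trans (T_lip _ _) _; rewrite exprS mulrCA ler_wpM2l// ltW.
have x_cvg i : cvgn (fun k => x k i ord0 : R).
  pose u k : R := x k i ord0.
  have u_cvg : cvgn (series (telescope u)).
    apply: normed_cvg; apply: (@series_le_cvg _ _ (geometric c beta)) => //.
    - by move=> k /=.
    - by move=> k; rewrite /geometric/= mulr_ge0 ?enorm_ge0// exprn_ge0 ?ltW.
    - move=> k; rewrite /geometric/= (le_trans _ (x_step k))//.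
      by apply: le_trans (entry_le_enorm _ i); rewrite !mxE.
    - by apply: is_cvg_geometric_series; rewrite gtr0_norm.
  have -> : (fun k => x k i ord0) = (fun k => u 0%N + series (telescope u) k).
    by apply/funext => k; rewrite -eq_sum_telescope.
  by apply: is_cvgD => //; exact: is_cvg_cst.
pose Q : 'cV[R]_d := \col_i limn (fun k => x k i ord0); exists Q.
have x_near eps : 0 < eps ->
    exists k0, forall k, (k0 <= k)%N -> enorm (Q - x k) <= d%:R * eps.
  move=> eps_gt0.
  have /fin_all_exists[K HK] i : exists k0, forall k, (k0 <= k)%N ->
      `|Q i ord0 - x k i ord0| < eps.
    have [k0 _ Hk0] := (cvgrPdist_lt _ _).1 (x_cvg i) _ eps_gt0.
    by exists k0 => k kk0; rewrite mxE; exact: Hk0.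
  exists (\max_i K i) => k Kk; rewrite enorm_fnorm (le_trans (fnorm_le_sumnorm _))//.
  apply: (@le_trans _ _ (\sum_(i < d) eps)).
    apply: ler_sum => i _; rewrite big_ord1 !mxE ltW//.
    have := HK i k (leq_trans (leq_bigmax i) Kk).
    by rewrite !mxE.
  by rewrite sumr_const card_ord mulr_natl.
apply/eqP; rewrite -subr_eq0; apply/eqP/enorm0_eq0/eqP.
rewrite eq_le enorm_ge0 andbT; apply/ler_addgt0Pr => eps eps_gt0.
rewrite add0r.
(* The dimension [d] may be [0], whence [d.+1] in the denominator. The distances of [x k0] and
   [x k0.+1] to [Q] then cost at most [eps / 2] each. *)
have [|k0 Hk0] := x_near (eps / (2 * d.+1%:R)).
  by rewrite divr_gt0// mulr_gt0.
have := Hk0 k0 (leqnn _); have := Hk0 k0.+1 (leqnSn _).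
have d_le : d%:R * (eps / (2 * d.+1%:R)) <= eps / 2 :> R.
  rewrite invfM; set y := (d.+1%:R)^-1.
  have -> : d%:R * (eps * (2^-1 * y)) = eps / 2 * (d%:R * y) by ring.
  rewrite ler_piMr ?divr_ge0 ?(ltW eps_gt0)//.
  by rewrite ler_pdivrMr ?ltr0n// mul1r ler_nat.
have := T_lip Q (x k0); have := enormD (T Q - T (x k0)) (x k0.+1 - Q).
rewrite [T (x k0)]/= -[T (x k0)]/(x k0.+1) subrKA (enormB _ Q).
have : beta * enorm (Q - x k0) <= enorm (Q - x k0).
  by rewrite ler_piMl ?enorm_ge0// ltW.
by move: d_le; set t := d%:R * _; lra.
Qed.

Lemma contraction_unique_fixed_point Q Q' : T Q = Q -> T Q' = Q' -> Q = Q'.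
Proof.
have [/andP[_ beta_lt1] T_lip] := T_contr => TQ TQ'.
apply/eqP; rewrite -subr_eq0; apply/eqP/enorm0_eq0/eqP.
rewrite eq_le enorm_ge0 andbT.
by have := T_lip Q Q'; have := enorm_ge0 (Q - Q'); rewrite TQ TQ'; nra.
Qed.

End FixedPoint.

(** * Bellman mappings *)

Section CoerciveInverse.
Context {R : realType} {n : nat}.

Lemma coercive_unit (A : 'M[R]_n) (c : R) : 0 < c ->
  (forall v, c * enorm v <= enorm (A *m v)) ->
  A \in unitmx /\ forall w, enorm (invmx A *m w) <= enorm w / c.
Proof.
move=> c_gt0 A_coer; have Au : A \in unitmx.
  rewrite -unitmx_tr -row_free_unit; apply: inj_row_free => v vA0.
  apply: trmx_inj; rewrite trmx0; apply: enorm0_eq0; apply/eqP.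
  rewrite eq_le enorm_ge0 andbT -(pmulr_rle0 _ c_gt0) (le_trans (A_coer _))//.
  by rewrite -[A]trmxK -trmx_mul vA0 trmx0 enorm0.
split=> // w; rewrite ler_pdivlMr// mulrC (le_trans (A_coer _))//.
by rewrite mulmxA mulmxV// mul1mx.
Qed.

(** The quadratic form of the matrix at [v] is at least [sigma |v|^2] and, by Cauchy-Schwarz, at
    most [|v|] times the right-hand side. *)
Lemma gram_coercive p (F : 'M[R]_(n, p)) (sigma : R) v : 0 < sigma ->
  sigma * enorm v <= enorm ((F *m F^T + sigma%:M) *m v).
Proof.
move=> sigma_gt0; have [v0|v_neq0] := eqVneq v 0.
  by rewrite v0 mulmx0 !enorm0 mulr0.
rewrite -(ler_pM2l (enorm_gt0 v_neq0)).
apply: le_trans (dot_le_enorm _ _); apply: le_trans (ler_norm _).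
rewrite mulmxDl mulmxDr mxE mul_scalar_mx -scalemxAr.
have -> : v^T *m (F *m F^T *m v) = (F^T *m v)^T *m (F^T *m v).
  by rewrite trmx_mul trmxK !mulmxA.
rewrite mulrCA -expr2 enorm_sqr [X in _ + X]mxE [X in _ + _ * X]mxE.
under [X in _ <= _ + _ * X]eq_bigr => i _ do rewrite mxE -expr2.
rewrite lerDr mxE; apply: sumr_ge0 => i _.
by rewrite mxE -expr2 sqr_ge0.
Qed.

(** A perturbation of at most [sigma / 2] leaves [A'] coercive with constant [sigma / 2]. The
    inverses differ by [A'^-1 (A - A') A^-1], hence the factor [2 / sigma^2]. *)
Lemma perturbed_inverse (A A' : 'M[R]_n) (sigma eps : R) : 0 < sigma ->
  (forall v, sigma * enorm v <= enorm (A *m v)) ->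
  fnorm (A' - A) <= eps -> eps <= sigma / 2 ->
  forall w, enorm (invmx A' *m w - invmx A *m w)
            <= 2 / sigma ^+ 2 * eps * enorm w.
Proof.
move=> sigma_gt0 A_coer A'A eps_le w.
have [Au invA_le] := coercive_unit sigma_gt0 A_coer.
have sigma2 : 0 < sigma / 2 by rewrite divr_gt0.
have [|A'u invA'_le] := @coercive_unit A' _ sigma2.
  move=> v; have := A_coer v; have := enormD (A' *m v) ((A - A') *m v).
  rewrite -mulmxDl addrCA subrr addr0 => + Av.
  have : enorm ((A - A') *m v) <= fnorm (A' - A) * enorm v.
    by rewrite -[A - A']opprB mulNmx enormN enorm_mulmx.
  have := ler_wpM2r (enorm_ge0 v) (le_trans A'A eps_le); lra.
have -> : invmx A' *m w - invmx A *m w = invmx A' *m ((A - A') *m (invmx A *m w)).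
  by rewrite mulmxBl mulmxBr mulKVmx// mulKmx.
apply: le_trans (invA'_le _) _; rewrite ler_pdivrMr//.
apply: le_trans (enorm_mulmx _ _) _.
have -> : 2 / sigma ^+ 2 * eps * enorm w * (sigma / 2) = eps * (enorm w / sigma).
  by field; rewrite gt_eqF.
apply: ler_pM; rewrite ?enorm_ge0 ?fnorm_ge0//.
move: A'A; congr (_ <= _); congr Num.sqrt.
by apply: eq_bigr => i _; apply: eq_bigr => j _; rewrite !mxE -sqrrN opprB.
Qed.

End CoerciveInverse.

Section BellmanEstimates.
Context {R : realType}.

Lemma inf_range_le (I : finType) (f g : I -> R) (delta : R) : 0 <= delta ->
  (forall a, f a <= g a + delta) -> inf (range f) <= inf (range g) + delta.
Proof.
(* For an empty action set both infima are [0] by convention. *)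
move=> delta_ge0 fg; have [a|I0] := pickP (pred_of_simpl (@predT I)); last first.
  have range0 (h : I -> R) : range h = set0.
    by apply/seteqP; split=> // y [a]; have := I0 a.
  by rewrite !range0 inf0 add0r.
move=> _; rewrite -lerBlDr; apply: lb_le_inf; first by exists (g a), a.
move=> _ [b _ <-]; rewrite lerBlDr; apply: le_trans (fg b).
apply: ge_inf; last by exists b.
exists (- \sum_b `|f b|) => _ [b' _ <-]; rewrite lerNl.
rewrite (le_trans (ler_norm _))// normrN (bigD1 b')//= lerDl.
exact: sumr_ge0.
Qed.

Lemma inf_range_dist (I : finType) (f g : I -> R) (delta : R) : 0 <= delta ->
  (forall a, `|f a - g a| <= delta) ->
  `|inf (range f) - inf (range g)| <= delta.
Proof.
move=> delta_ge0 fg; rewrite ler_norml lerBlDl lerNl opprB lerBlDl.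
by apply/andP; split; rewrite inf_range_le// => a; have := fg a;
  rewrite ler_norml => /andP[]; lra.
Qed.

Context {N : nat}.
Variable P : rl_data R N.
Local Notation D := (fdim P).

(** An infimum over finitely many actions is 1-Lipschitz for the maximum distance, and each Q-value
    is Lipschitz with the norm of its feature vector. Summing over samples and nodes makes the
    constant uniform. *)
Lemma cvec_lipschitz : 0 < discount P -> exists2 c, 0 <= c &
  forall n (Q1 Q2 : 'cV[R]_D), enorm (cvec n Q1 - cvec n Q2) <= c * enorm (Q1 - Q2).
Proof.
move=> disc_gt0.
pose b n (i : 'I_(nsamples P n)) :=
  discount P * \sum_a enorm (rff (feat (next_state i) a)).
have b_ge0 n i : 0 <= @b n i.
  by rewrite mulr_ge0 ?(ltW disc_gt0)// sumr_ge0// => a _; exact: enorm_ge0.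
exists (\sum_n \sum_i @b n i) => [|n Q1 Q2].
  by apply: sumr_ge0 => n _; apply: sumr_ge0.
apply: (@le_trans _ _ ((\sum_i @b n i) * enorm (Q1 - Q2))); last first.
  rewrite ler_wpM2r ?enorm_ge0// [leRHS](bigD1 n)//= lerDl.
  by apply: sumr_ge0 => k _; apply: sumr_ge0.
rewrite enorm_fnorm (le_trans (fnorm_le_sumnorm _))// mulr_suml.
apply: ler_sum => i _; rewrite big_ord1 !mxE opprD addrACA subrr add0r -mulrBr normrM.
rewrite (gtr0_norm disc_gt0) /b -mulrA ler_wpM2l ?(ltW disc_gt0)//.
apply: inf_range_dist.
  by rewrite mulr_ge0 ?enorm_ge0// sumr_ge0// => a _; exact: enorm_ge0.
move=> a.
have -> : qval Q1 (feat (next_state i) a) - qval Q2 (feat (next_state i) a) =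
    ((Q1 - Q2)^T *m rff (feat (next_state i) a)) ord0 ord0.
  by rewrite /qval linearB mulmxBl [RHS]mxE; congr (_ + _); rewrite [RHS]mxE.
apply: le_trans (dot_le_enorm _ _) _; rewrite mulrC ler_wpM2r ?enorm_ge0//.
by rewrite (bigD1 a)//= lerDl sumr_ge0// => k _; exact: enorm_ge0.
Qed.

End BellmanEstimates.

(** * Value iteration as a perturbed contraction *)

Section Algorithm.
Context {R : realType} {N : nat}.
Variables (e : rel 'I_N) (lambda : 'I_N -> R) (varpi eta sigma : R).
Hypotheses (N_gt1 : (1 < N)%N) (e_conn : connected_graph e).
Hypothesis lambda_eig : eigenvalues_desc (laplacian R e) lambda.
Hypotheses (varpi_bd : 2^-1 <= varpi < 1) (eta_bd : 0 < eta < 2 * (1 - varpi)).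
Variable P : rl_data R N.
Hypotheses (sigma_gt0 : 0 < sigma) (discount_gt0 : 0 < discount P).
Local Notation D := (fdim P).
Local Notation rho := (rate lambda (step_size R e) varpi eta).
Local Notation cov := (PhiN P *m (PhiN P)^T).
Local Notation target n Q := (Phi P n *m cvec n Q).

Lemma target_lipschitz : exists2 c, 0 <= c & forall n (Q1 Q2 : 'cV[R]_D),
  enorm (target n Q1 - target n Q2) <= c * enorm (Q1 - Q2).
Proof.
have [c c_ge0 cvec_lip] := cvec_lipschitz discount_gt0.
exists ((\sum_n fnorm (Phi P n)) * c).
  by rewrite mulr_ge0// sumr_ge0// => n _; exact: fnorm_ge0.
move=> n Q1 Q2; rewrite -mulmxBr (le_trans (enorm_mulmx _ _))// -mulrA.
apply: ler_pM; rewrite ?fnorm_ge0 ?enorm_ge0 ?cvec_lip//.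
by rewrite (bigD1 n)//= lerDl sumr_ge0// => k _; exact: fnorm_ge0.
Qed.

Lemma target_bounded B : exists2 c, 0 <= c & forall n (Q : 'cV[R]_D),
  enorm Q <= B -> enorm (target n Q) <= c.
Proof.
have [c c_ge0 lip] := target_lipschitz.
exists (\sum_n enorm (target n (0 : 'cV[R]_D)) + c * `|B|).
  by rewrite addr_ge0 ?mulr_ge0// sumr_ge0// => n _; exact: enorm_ge0.
move=> n Q QB; rewrite -(subrK (target n 0) (target n Q)) addrC.
rewrite (le_trans (enormD _ _))// lerD//.
  by rewrite (bigD1 n)//= lerDl sumr_ge0// => k _; exact: enorm_ge0.
rewrite (le_trans (lip _ _ _))// subr0 ler_wpM2l// (le_trans QB)//.
exact: ler_norm.
Qed.

Lemma covariance_coercive v :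
  sigma * enorm v <= enorm ((cov + sigma%:M) *m v).
Proof. exact: gram_coercive. Qed.

Lemma covariance_inverse_le w : enorm (invmx (cov + sigma%:M) *m w) <= enorm w / sigma.
Proof. by have [_] := coercive_unit sigma_gt0 covariance_coercive; apply. Qed.

Section Updates.
Variables (M JC : nat).
Hypotheses (M_gt0 : (0 < M)%N) (JC_bd : (0 < JC <= M)%N).

(** At least one covariance update occurs between consecutive indices, so the estimate at index [k]
    is an iterate of index at least [k]. *)
Lemma Chat_cvg eps : 0 < eps -> exists k0, forall k, (k0 <= k)%N -> forall n,
  fnorm (Chat P e varpi eta M JC k n - cov) <= eps.
Proof.
move=> eps_gt0.
have [K K_ge0 boundK] :=
  covariance_consensus N_gt1 e_conn lambda_eig varpi_bd eta_bd P.
have /andP[rho_gt0 rho_lt1] := rate_gt0_lt1 N_gt1 e_conn lambda_eig varpi_bd eta_bd.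
have [|k0 Hk0] := @linear_geometric_small _ K rho _ K_ge0 _ eps_gt0.
  by rewrite (ltW rho_gt0).
exists k0 => k k0k n; rewrite (le_trans (boundK n _))// ltW// Hk0//.
rewrite (leq_trans k0k)// leq_pmulr// /ceil_div addn_gt0 divn_gt0.
  by have /andP[_ ->] := JC_bd.
by have /andP[] := JC_bd.
Qed.

Lemma bellman_nodalE k n (Q : 'cV[R]_D) :
  bellman_nodal e varpi eta sigma M JC k n Q =
  invmx (Chat P e varpi eta M JC k n + sigma%:M) *m target n Q.
Proof. by rewrite /bellman_nodal /Psi mulmxA. Qed.

Lemma bellman_all_sum k (X : 'M[R]_(D, N)) :
  bellman_all e varpi eta sigma M JC k X *m const_mx 1 =
  \sum_n bellman_nodal e varpi eta sigma M JC k n (col n X) :> 'cV[R]_D.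
Proof.
apply/matrixP => i j; rewrite ord1 summxE mxE; apply: eq_bigr => n _.
by rewrite [const_mx _ _ _]mxE mulr1 [LHS]mxE.
Qed.

End Updates.

Lemma bellman_centralizedE (Q : 'cV[R]_D) : bellman_centralized sigma Q =
  \sum_n invmx (cov + sigma%:M) *m target n Q.
Proof. by apply: eq_bigr => n _; rewrite mulmxA. Qed.

Lemma sumnorm_le_cols d p (X : 'M[R]_(d, p)) B :
  (forall n, enorm (col n X) <= B) -> sumnorm X <= d%:R * p%:R * B.
Proof.
move=> XB; apply: (@le_trans _ _ (\sum_(i < d) \sum_(n < p) B)).
  apply: ler_sum => i _; apply: ler_sum => n _; apply: le_trans (XB n).
  by apply: le_trans (entry_le_enorm _ i); rewrite mxE.
by rewrite !sumr_const !card_ord -[B *+ p]mulr_natl -[_ *+ d]mulr_natl mulrA.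
Qed.

(** One step is the centralized mapping at node [n] plus three errors: imperfect consensus after [M]
    inner steps, the inexact covariance inverse, and the disagreement of the nodal arguments. The
    second tends to [0], the others are [O(M rho^M)]. All constants are fixed before [M] and
    [JC]. *)
Lemma Qiter_near_fixed_point beta (Q0 : 'M[R]_(D, N)) (Qc : 'cV[R]_D) :
  contraction_with (bellman_centralized (P := P) sigma) beta ->
  bellman_centralized sigma Qc = Qc ->
  forall B : R, exists2 C : R, 0 < C &
    forall M JC : nat, (0 < M)%N -> (0 < JC <= M)%N ->
    (forall (n : 'I_N) (k : nat),
       enorm (col n (Qiter e varpi eta sigma M JC Q0 k)) <= B) ->
    forall n : 'I_N,
      (limn_esup (fun k : nat =>
         (enorm (col n (Qiter e varpi eta sigma M JC Q0 k) - Qc))%:E)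
       <= (C * (1 / (1 - beta)) * M%:R * rho ^+ M)%:E)%E.
Proof.
move=> [beta_bd T_lip] TQc B; have /andP[beta_gt0 beta_lt1] := beta_bd.
have /andP[rho_gt0 _] := rate_gt0_lt1 N_gt1 e_conn lambda_eig varpi_bd eta_bd.
have [K K_ge0 boundK] := consensus_col N_gt1 e_conn lambda_eig varpi_bd eta_bd.
have [h h_ge0 target_lip] := target_lipschitz.
have [b b_ge0 target_le] := target_bounded B.
(* Bounds a nodal Bellman value once the covariance error is at most [sigma / 2]: the exact inverse
   plus its perturbation. *)
pose tau := b / sigma + 2 / sigma ^+ 2 * (sigma / 2) * b.
have tau_ge0 : 0 <= tau.
  by rewrite addr_ge0 ?(mulr_ge0, invr_ge0, exprn_ge0, ltW sigma_gt0).
(* The final factor [2] comes from [M + 1 <= 2 M]. *)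
pose C1 := D%:R * K * (D%:R * N%:R * `|B| + D%:R * N%:R * tau) * 2.
have C1_ge0 : 0 <= C1 by rewrite !mulr_ge0// addr_ge0// !mulr_ge0.
(* [C1] is the consensus error of the current step. The previous step leaves nodes at most
   [(C1 + C1) w] apart, which [h] and [1 / sigma] carry through the [N] Bellman values. *)
pose C2 := C1 + N%:R * (h * (C1 + C1) / sigma).
have C2_ge0 : 0 <= C2.
  rewrite addr_ge0// mulr_ge0// divr_ge0 ?(ltW sigma_gt0)//.
  by rewrite mulr_ge0// addr_ge0.
exists (C2 + 1); first by lra.
move=> M JC M_gt0 JC_bd XB n.
set X := Qiter e varpi eta sigma M JC Q0 in XB *.
set w := M%:R * rho ^+ M.
have w_ge0 : 0 <= w by rewrite mulr_ge0// exprn_ge0// ltW.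
pose t k : 'cV[R]_D := bellman_all e varpi eta sigma M JC k (X k) *m const_mx 1.
have nodal_close k m eps : fnorm (Chat P e varpi eta M JC k m - cov) <= eps ->
    eps <= sigma / 2 ->
    enorm (bellman_nodal e varpi eta sigma M JC k m (col m (X k))
           - invmx (cov + sigma%:M) *m target m (col m (X k)))
    <= 2 / sigma ^+ 2 * eps * b.
  move=> C_close eps_le; rewrite bellman_nodalE.
  have eps_ge0 : 0 <= eps by rewrite (le_trans (fnorm_ge0 _) C_close).
  apply: le_trans (perturbed_inverse sigma_gt0 covariance_coercive _ eps_le _) _.
    by rewrite opprD addrACA subrr addr0.
  rewrite ler_wpM2l ?target_le//.
  by rewrite mulr_ge0// divr_ge0// exprn_ge0// ltW.
have sigma2 : 0 < sigma / 2 by rewrite divr_gt0.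
have [k0 Hk0] := Chat_cvg JC_bd sigma2.
have near_t k m : (k0 <= k)%N -> enorm (col m (X k.+1) - t k) <= C1 * w.
  move=> k0k; apply: le_trans (boundK _ _ _ _ _) _.
  set TX := bellman_all _ _ _ _ _ _ _ _.
  have TX_le : sumnorm TX <= D%:R * N%:R * tau.
    apply: sumnorm_le_cols => m'.
    have -> : col m' TX = bellman_nodal e varpi eta sigma M JC k m' (col m' (X k)).
      by apply/matrixP => i j; rewrite ord1 !mxE.
    set y := bellman_nodal _ _ _ _ _ _ _ _ _.
    rewrite -(subrK (invmx (cov + sigma%:M) *m target m' (col m' (X k))) y).
    rewrite (le_trans (enormD _ _))// addrC lerD//.
      rewrite (le_trans (covariance_inverse_le _))// ler_wpM2r ?invr_ge0 ?(ltW sigma_gt0)//.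
      by rewrite target_le.
    by apply: nodal_close => //; exact: Hk0.
  have X_le : sumnorm (X k) <= D%:R * N%:R * `|B|.
    by apply: sumnorm_le_cols => m'; apply: le_trans (XB m' k) (ler_norm B).
  have M2 : M.+1%:R <= 2 * M%:R :> R by rewrite -natr1 mulrDl mul1r lerD2l ler1n.
  rewrite /C1 /w mulrA ler_wpM2r ?exprn_ge0 ?(ltW rho_gt0)//.
  rewrite -[leRHS]mulrA; apply: ler_pM => //.
    by rewrite !mulr_ge0// addr_ge0 ?sumnorm_ge0.
  by rewrite ler_wpM2l ?mulr_ge0// lerD.
pose W := C2 * w.
have step eps : 0 < eps -> exists k1, forall k, (k1 <= k)%N ->
    enorm (col n (X k.+1) - Qc) <= beta * enorm (col n (X k) - Qc) + W + eps.
  move=> eps_gt0.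
  pose c5 := 2 / sigma ^+ 2 * b * N%:R + 1.
  have c5_gt0 : 0 < c5.
    by rewrite ltr_wpDl// !mulr_ge0// ?invr_ge0 ?exprn_ge0 ?(ltW sigma_gt0).
  (* The first bound keeps the perturbed matrices coercive; the second makes the total inversion
     error at most [eps]. *)
  pose delta := Num.min (sigma / 2) (eps / c5).
  have delta_gt0 : 0 < delta by rewrite lt_min sigma2 divr_gt0.
  have [k1 Hk1] := Chat_cvg JC_bd delta_gt0.
  (* Disagreement at index [k] is estimated from the step starting at [k - 1], so [k] must exceed
     [k0]. *)
  exists (maxn k0.+1 k1) => k; rewrite geq_max => /andP[k0k k1k].
  pose x := col n (X k).
  pose u m := bellman_nodal e varpi eta sigma M JC k m (col m (X k)).
  pose v m := invmx (cov + sigma%:M) *m target m (col m (X k)).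
  pose z m := invmx (cov + sigma%:M) *m target m x.
  have tE : t k = \sum_m u m by exact: bellman_all_sum.
  have TxE : bellman_centralized sigma x = \sum_m z m.
    exact: bellman_centralizedE.
  have -> : col n (X k.+1) - Qc = (col n (X k.+1) - t k)
      + \sum_m (u m - v m) + \sum_m (v m - z m)
      + (bellman_centralized sigma x - bellman_centralized sigma Qc).
    by rewrite (sumrB _ _ u v) (sumrB _ _ v z) TQc TxE tE !subrKA.
  apply: le_trans (enormD _ _) _.
  rewrite -[leRHS]addrA [leRHS]addrC; apply: lerD (T_lip _ _).
  have term2 : enorm (\sum_m (u m - v m)) <= eps.
    apply: le_trans (enorm_sum _ _ _) _.
    apply: (@le_trans _ _ (\sum_(m < N) 2 / sigma ^+ 2 * delta * b)).
      apply: ler_sum => m _; apply: nodal_close; first exact: Hk1.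
      by rewrite ge_min lexx.
    rewrite sumr_const card_ord -mulr_natr.
    apply: (@le_trans _ _ (c5 * delta)).
      rewrite /c5 mulrDl -[leLHS]addr0; apply: lerD.
        by rewrite le_eqVlt; apply/orP; left; apply/eqP; ring.
      by rewrite mul1r ltW.
    have : delta <= eps / c5 by rewrite ge_min lexx orbT.
    by rewrite (ler_pdivlMr _ _ c5_gt0) mulrC.
  have term3 : enorm (\sum_m (v m - z m))
      <= N%:R * (h * (C1 + C1) / sigma) * w.
    apply: le_trans (enorm_sum _ _ _) _.
    apply: (@le_trans _ _ (\sum_(m < N) h * (C1 * w + C1 * w) / sigma)).
      apply: ler_sum => m _; rewrite /v /z -mulmxBr.
      apply: le_trans (covariance_inverse_le _) _.
      rewrite ler_wpM2r ?invr_ge0 ?(ltW sigma_gt0)// (le_trans (target_lip _ _ _))//.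
      rewrite ler_wpM2l// /x.
      have -> : k = k.-1.+1 by case: (k) k0k.
      have {}k0k : (k0 <= k.-1)%N by case: (k) k0k.
      rewrite -(subrKA (t k.-1)) (le_trans (enormD _ _))//.
      by apply: lerD; [|rewrite enormB]; exact: near_t.
    rewrite sumr_const card_ord -[_ *+ N]mulr_natl.
    by rewrite le_eqVlt; apply/orP; left; apply/eqP; ring.
  have term1 := near_t k n (ltnW k0k).
  have WE : W + eps = C1 * w + eps + N%:R * (h * (C1 + C1) / sigma) * w.
    by rewrite /W /C2 mulrDl addrAC.
  rewrite WE; set a := col n (X k.+1) - t k in term1 *.
  move: term1 term2 term3; set su := \sum_m (u m - v m).
  set sv := \sum_m (v m - z m) => term1 term2 term3.
  have a_su := le_trans (enormD a su) (lerD term1 term2).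
  exact: le_trans (enormD (a + su) sv) (lerD a_su term3).
apply: le_trans (limn_esup_contraction beta_bd step) _.
have -> : (C2 + 1) * (1 / (1 - beta)) * M%:R * rho ^+ M =
    (C2 + 1) * w / (1 - beta).
  by rewrite /w div1r; ring.
rewrite lee_fin ler_wpM2r ?invr_ge0 ?subr_ge0 ?(ltW beta_lt1)//.
by rewrite ler_wpM2r// lerDl.
Qed.

End Algorithm.

Theorem theorem5 (R : realType) (N : nat) (e : rel 'I_N) (P : rl_data R N)
    (lambda : 'I_N -> R) (varpi eta sigma : R) (Q0 : 'M[R]_(fdim P, N)) :
  (1 < N)%N ->
  connected_graph e ->
  eigenvalues_desc (laplacian R e) lambda ->
  2^-1 <= varpi < 1 ->
  0 < eta < 2 * (1 - varpi) ->
  0 < sigma ->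
  0 < discount P ->
  let rho := rate lambda (step_size R e) varpi eta in
  [/\ (* (i) *)
      0 < rho < 1,
      (* (ii) *)
      forall M JC : nat, (0 < M)%N -> (0 < JC <= M)%N ->
      forall (k : nat) (n : 'I_N),
        let Qk := Qiter e varpi eta sigma M JC Q0 k in
        (fun m : nat =>
           enorm (col n (inner_seq e varpi eta sigma M JC k Qk m)
                  - bellman_all e varpi eta sigma M JC k Qk *m const_mx 1))
          =O_\oo (fun m : nat => m%:R * rho ^+ m),
      (* (iii) *)
      forall n : 'I_N,
        (fun l : nat =>
           fnorm (block (Cseq P e varpi eta l) n - PhiN P *m (PhiN P)^T))
          =O_\oo (fun l : nat => l%:R * rho ^+ l)
    & (* (iv) *)
      forall beta : R, contraction_with (bellman_centralized (P := P) sigma) beta ->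
      exists2 Qc : 'cV[R]_(fdim P),
        unique (fun Q => bellman_centralized sigma Q = Q) Qc &
        (* C does not depend on M or JC, only on the bound B of the iterates
           besides the fixed data *)
        forall B : R, exists2 C : R, 0 < C &
          forall M JC : nat, (0 < M)%N -> (0 < JC <= M)%N ->
          (forall (n : 'I_N) (k : nat),
             enorm (col n (Qiter e varpi eta sigma M JC Q0 k)) <= B) ->
          forall n : 'I_N,
            (limn_esup (fun k : nat =>
               (enorm (col n (Qiter e varpi eta sigma M JC Q0 k) - Qc))%:E)
             <= (C * (1 / (1 - beta)) * M%:R * rho ^+ M)%:E)%E ].
Proof.
move=> N_gt1 e_conn lambda_eig varpi_bd eta_bd sigma_gt0 discount_gt0 rho.
have rho_bd : 0 < rho < 1 by exact: rate_gt0_lt1.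
have /andP[rho_gt0 _] := rho_bd.
split=> //.
- move=> M JC _ _ k n Qk.
  have [K K_ge0 boundK] := consensus_col N_gt1 e_conn lambda_eig varpi_bd eta_bd.
  set TQ := bellman_all e varpi eta sigma M JC k Qk.
  apply: (@eqO_linear_geometric _ _ ((fdim P)%:R * K * (sumnorm Qk + sumnorm TQ))).
  + by rewrite !mulr_ge0// addr_ge0// sumnorm_ge0.
  + exact: ltW.
  + by move=> m; rewrite enorm_ge0 /=; exact: boundK.
- move=> n; have [K K_ge0 boundK] :=
    covariance_consensus N_gt1 e_conn lambda_eig varpi_bd eta_bd P.
  apply: (eqO_linear_geometric K_ge0 (ltW rho_gt0)) => l.
  by rewrite fnorm_ge0 /=; exact: boundK.
- move=> beta T_contr.
  have [Qc TQc] := contraction_fixed_point T_contr.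
  exists Qc; first by split=> // Q TQ; exact: (contraction_unique_fixed_point T_contr TQc TQ).
  exact: Qiter_near_fixed_point.
Qed.
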